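(* For $N\ge0$, consider the wave $\phi_Ne^{-i\omega_Nt}$, with $\omega_N=\mathcal{E}(\phi_N)$, which is a solution of the continuous resonant equation $i\partial_tu=\mathcal{T}(u,u,u)$. The following stability/instability results hold in the Bargmann--Fock space: (i) If $N=0$ or $N=1$, this wave is linearly stable. (ii) If $N\ge2$, it is linearly unstable. (iii) The number of unstable modes of the $N$-th wave is $o(N)$ (as $N\to\infty$).
   Context: Identify $\mathbb{R}^2$ with $\mathbb{C}$. The Bargmann--Fock space is the set of $L^2(\mathbb{R}^2)$ functions of the form $g(z)e^{-|z|^2/2}$ with $g$ entire; it has the orthonormal basis $\phi_n(z)=\frac1{\sqrt{\pi n!}}z^ne^{-|z|^2/2}$, $n\ge0$, and is invariant under the equation $i\partial_tu=\mathcal{T}(u,u,u)$, where, with $x^\perp=(-x_2,x_1)$, $$\mathcal{T}(f_1,f_2,f_3)(z)=\frac12\int_{\mathbb{R}}\int_{\mathbb{R}^2} f_1(x+z)f_2(\lambda x^\perp+z)\overline{f_3(x+\lambda x^\perp+z)}\,dx\,d\lambda .$$ Moreover $\mathcal{E}(f)=\int_{\mathbb{R}^2}\mathcal{T}(f,f,f)\overline f$. Put $\alpha_{n_1,n_2,n_3,n_4}=\int_{\mathbb{R}^2}\mathcal{T}(\phi_{n_1},\phi_{n_2},\phi_{n_3})\overline{\phi_{n_4}}=\frac{\pi}{2}\frac{(n_1+n_2)!}{2^{n_1+n_2}\sqrt{n_1!n_2!n_3!n_4!}}$ if $n_1+n_2=n_3+n_4$ (and $0$ otherwise), so $\omega_N=\alpha_{N,N,N,N}$.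 Writing $u=\sum_{n\ge0}c_n\phi_n$, the linearization of the equation (restricted to the Bargmann--Fock space) around the wave is $$i\dot c_N=2\omega_Nc_N+\omega_Ne^{-2i\omega_Nt}\overline{c_N},$$ $$i\dot c_k=2\alpha_{k,N,k,N}c_k+\alpha_{2N-k,k,N,N}\,e^{-2i\omega_Nt}\,\overline{c_{2N-k}}\quad(0\le k\le 2N,\ k\ne N),$$ $$i\dot c_k=2\alpha_{k,N,k,N}c_k\quad(k\ge2N+1).$$ Linear stability is understood as the absence of an exponentially growing mode of this linear system, and linear instability as the existence of one. The linearized system couples only $c_k$ and $c_{2N-k}$; the unstable modes are the indices $k$ for which the corresponding subsystem has exponentially growing solutions. *)

(* Defs.v *)
From HB Require Import structures.
From mathcomp Require Import all_boot all_order all_algebra.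
From mathcomp Require Import all_classical all_reals all_analysis.
From mathcomp Require Import finmap complex.

Set Implicit Arguments.
Unset Strict Implicit.
Unset Printing Implicit Defensive.

Import Order.TTheory GRing.Theory Num.Theory.
Import numFieldNormedType.Exports.

Local Open Scope classical_set_scope.
Local Open Scope ring_scope.
Local Open Scope complex_scope.

Section Defs.
Variable R : realType.
Local Notation C := R[i].

(* Re z and Im z are the values in R, not the R[i]-valued 'Re z and 'Im z.   *)
Local Notation re := (@complex.Re R).
Local Notation im := (@complex.Im R).
Local Notation mu := (@lebesgue_measure R).

Definition cexp (z : C) : C :=
  (expR (re z))%:C * (cos (im z) +i* sin (im z)).

Definition is_cderive (c : R -> C) (t : R) (d : C) : Prop :=
  is_derive t (1 : R) (fun s => re (c s)) (re d) /\
  is_derive t (1 : R) (fun s => im (c s)) (im d).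

(* Lebesgue integrals of complex-valued functions over R and over R^2 = C;   *)
(* they are used below on absolutely integrable functions.                   *)
Definition cintR (f : R -> C) : C :=
  Rintegral mu setT (fun x => re (f x)) +i*
  Rintegral mu setT (fun x => im (f x)).

Definition cintC (f : C -> C) : C :=
  Rintegral (mu \x mu)%E setT (fun p : R * R => re (f (p.1 +i* p.2))) +i*
  Rintegral (mu \x mu)%E setT (fun p : R * R => im (f (p.1 +i* p.2))).

Definition perp (x : C) : C := (- im x) +i* re x.

Definition resonantT (f1 f2 f3 : C -> C) (z : C) : C :=
  2^-1 * cintR (fun l => cintC (fun x =>
    f1 (x + z) * f2 (l%:C * perp x + z) * (f3 (x + l%:C * perp x + z))^*)).

Definition energy (f : C -> C) : C :=
  cintC (fun z => resonantT f f f z * (f z)^*).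

Definition resonant_solution (u : R -> C -> C) : Prop :=
  forall (t : R) (z : C), exists d : C,
    is_cderive (fun s => u s z) t d /\ 'i%C * d = resonantT (u t) (u t) (u t) z.

Definition phi (n : nat) (z : C) : C :=
  ((Num.sqrt (pi * n`!%:R))^-1)%:C * z ^+ n
  * (expR (- (Normc.normc z ^+ 2 / 2)))%:C.

Definition alpha (n1 n2 n3 n4 : nat) : C :=
  cintC (fun z => resonantT (phi n1) (phi n2) (phi n3) z * (phi n4 z)^*).

Definition omega (N : nat) : C := energy (phi N).

Definition wave (N : nat) (t : R) (z : C) : C :=
  phi N z * cexp (- ('i%C * omega N * t%:C)).

(* The function u(t) = \sum_k c_k(t) phi_k is represented by its             *)
(* coefficients; c t k is c_k(t).                                            *)

(* The squared L^2 norm of \sum_k c_k phi_k; it is +oo outside of l^2.       *)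
Definition sqnorm (c : nat -> C) : \bar R :=
  (\sum_(0 <= k <oo) ((Normc.normc (c k)) ^+ 2)%:E)%E.

(* The subtraction 2N - k is only used when k <= 2N.                         *)
Definition linearized_rhs (N : nat) (t : R) (c : nat -> C) (k : nat) : C :=
  let rot := cexp (- (2 * 'i%C * omega N * t%:C)) in
  if k == N then
    2 * omega N * c N + omega N * rot * (c N)^*
  else if (k <= 2 * N)%N then
    2 * alpha k N k N * c k
    + alpha (2 * N - k) k N N * rot * (c (2 * N - k)%N)^*
  else 2 * alpha k N k N * c k.

(* Solutions with values in the Bargmann-Fock space.                         *)
Definition linearized_solution (N : nat) (c : R -> nat -> C) : Prop :=
  (forall t : R, (sqnorm (c t) < +oo)%E) /\
  (forall (t : R) (k : nat), exists d : C,
     is_cderive (fun s => c s k) t d /\ 'i%C * d = linearized_rhs N t (c t) k).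

Definition exponentially_growing (c : R -> nat -> C) : Prop :=
  exists sigma A : R, [/\ 0 < sigma, 0 < A &
    forall t : R, 0 <= t ->
      (((A * expR (sigma * t)) ^+ 2)%:E <= sqnorm (c t))%E].

Definition linearly_unstable (N : nat) : Prop :=
  exists c : R -> nat -> C, linearized_solution N c /\ exponentially_growing c.

Definition linearly_stable (N : nat) : Prop :=
  ~ exists c : R -> nat -> C,
      linearized_solution N c /\ exponentially_growing c.

(* The subsystem of index k involves c_k and, if k <= 2N, c_(2N-k); its      *)
(* solutions are the solutions of the whole system supported there.          *)
Definition unstable_modes (N : nat) : set nat :=
  [set k | exists c : R -> nat -> C,
     [/\ linearized_solution N c,
         forall (t : R) (j : nat), j != k -> (j + k != 2 * N)%N -> c t j = 0 &
         exponentially_growing c]].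

Definition nb_unstable_modes (N : nat) : nat :=
  #|` fset_set (unstable_modes N)|%N.

End Defs.

(* Main.v *)
(* On the Bargmann-Fock side all integrals are Gaussian.  With
   [w = (1 + i l) x + z], [u = (w + z) / 2], [v = (w - z) / 2] and
   [q = (1 - i l) / (1 + i l)], the integrand of [T(phi_n1, phi_n2, phi_n3)] is,
   up to constants, [(u + q v)^n1 (u - q v)^n2 conj(w)^n3 exp (- |w|^2)].  The
   integral over [l] kills every positive power of [q], and the moments of the
   Gaussian in [w] kill every power of [w] but the [n3]-th; this yields the
   coefficients [alpha].

   The linearized equation then splits into the pairs [(k, l)], [l = 2 N - k].
   With [S = a_k + a_l - omega] and [b] the cross coefficient, such a pair has
   a definite conserved quadratic form if [b < |S|] and an exponentially growing
   mode if [|S| < b].  The pair [k = N - 2] is unstable for every [N >= 2],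
   whereas [a_(N-j)], [a_(N+j)] and [b] are all below [omega / 3] once
   [j ^ 2 > 16 N], so that only [O (sqrt N)] modes can be unstable. *)
Require Import Defs.
From mathcomp Require Import all_boot all_order all_algebra.
From mathcomp Require Import all_classical all_reals all_analysis.
From mathcomp Require Import complex.
From mathcomp Require Import measurable_realfun ring lra zify.

Import Order.TTheory GRing.Theory Num.Theory.
Import numFieldNormedType.Exports.

Set Implicit Arguments.
Unset Strict Implicit.
Unset Printing Implicit Defensive.

Local Open Scope classical_set_scope.
Local Open Scope ring_scope.

(** * Change of variables and complex integrals *)

(** The sign of [b - |S|] is read off from two recursions, a_(k+1) / a_k = (k + 1 + N) / (2 (k + 1))
    and b_(k+1)^2 / b_k^2 = (2 N - k) / (k + 1), both started from the value omega at k = N. They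
    explain which pair is unstable. For N >= 1 one has a_(N-1) = omega, so the pair k = N - 1
    satisfies S^2 - b^2 = omega^2 / (4 (N + 1)^2) > 0: the nearest pair is always stable, which
    settles N = 1 and makes k = N - 2 the first candidate. Far from N both a's and b are small and S
    is negative. The bound omega / 3 is the largest common one that still forces S < - omega / 3 < -
    b. Two families escape this dichotomy: k = N, where b = |S| and the amplitude may grow linearly,
    and the infinitely many k > 2 N, which only rotate. Stability is therefore proved by comparing
    the squared norm with a quadratic polynomial in time, not by boundedness. *)

Section AffineChangeOfVariables.
Context {R : realType}.
Local Notation mu := (@lebesgue_measure R).
Local Notation mu2 := (mu \x mu)%E.

(** The image of Lebesgue measure under [a * x + b], scaled by [|a|], gives half-open intervals
    their length, hence is Lebesgue measure by uniqueness. *)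
Lemma ge0_integral_affine (f : R -> \bar R) (a b : R) :
  a != 0 -> measurable_fun setT f -> (forall x, 0 <= f x)%E ->
  (\int[mu]_x f x = `|a|%:E * \int[mu]_x f (a * x + b)%R)%E.
Proof.
move=> a0 mf f0.
pose phi (x : R) : measurableTypeR R := a * x + b.
have mphi : measurable_fun setT phi.
  by apply: measurable_funD => //; exact: measurable_funM.
pose m1 : {measure set (measurableTypeR R) -> \bar R} :=
  measure_function_pushforward__canonical__measure_function_Measure mu mphi.
pose m2 := mscale (NngNum (normr_ge0 a)) m1.
have muE A : measurable A -> mu A = m2 A.
  move: A; apply: lebesgue_measure_unique => _ [[c d] _ <-]/=.
  rewrite /m2 /mscale/= /pushforward.
  have [an|ap|/eqP] := ltgtP a 0; last by rewrite (negPf a0).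
    have -> : phi @^-1` `]c, d]%classic = `[(d - b) / a, (c - b) / a[%classic.
      apply/seteqP; split => x; rewrite /phi/= !in_itv/=;
        by rewrite ler_ndivrMr// ltr_ndivlMr// ltrBlDr lerBrDr mulrC andbC.
    rewrite !lebesgue_measure_itv/= !lte_fin ltr_nM2r ?invr_lt0// ltrD2r.
    case: ifP => _; last by rewrite mule0.
    by rewrite ltr0_norm// -!EFinD -EFinM; congr EFin; field.
  have -> : phi @^-1` `]c, d]%classic = `](c - b) / a, (d - b) / a]%classic.
    apply/seteqP; split => x; rewrite /phi/= !in_itv/=;
      by rewrite ltr_pdivrMr// ler_pdivlMr// ltrBlDr lerBrDr mulrC.
  rewrite !lebesgue_measure_itv/= !lte_fin ltr_pM2r ?invr_gt0// ltrD2r.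
  case: ifP => _; last by rewrite mule0.
  by rewrite gtr0_norm// -!EFinD -EFinM; congr EFin; field.
rewrite (eq_measure_integral m2); last by move=> A mA _; exact: muE.
by rewrite ge0_integral_mscale//= ge0_integral_pushforward.
Qed.

(* The matrix of [z |-> (a + i b) z] is a product of shears and diagonal
   matrices, so that Tonelli's theorem reduces the claim to dimension one. *)
Lemma ge0_integral_complex_affine (f : R * R -> \bar R) (a b z1 z2 : R) :
  0 < a -> measurable_fun setT f -> (forall x, 0 <= f x)%E ->
  (\int[mu2]_x f x = (a ^+ 2 + b ^+ 2)%:E *
   \int[mu2]_x f (a * x.1 - b * x.2 + z1, a * x.2 + b * x.1 + z2)%R)%E.
Proof.
move=> a0 mf f0.
have aN0 : a != 0 by rewrite gt_eqF.
(* Taking a x.1 - b x.2 + z1 as the new first coordinate x turns the second one into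
   [D * x.2 + c x]. The two one-dimensional substitutions then have factors a and [D], with product
   a^2 + b^2. *)
pose D := (a ^+ 2 + b ^+ 2) / a.
pose c x := (b / a) * (x - z1) + z2.
have D0 : 0 < D by rewrite divr_gt0// ltr_wpDr ?sqr_ge0// exprn_gt0.
pose g (x : measurableTypeR R * measurableTypeR R) :=
  f (a * x.1 - b * x.2 + z1, a * x.2 + b * x.1 + z2).
pose h (x : measurableTypeR R * measurableTypeR R) := f (x.1, D * x.2 + c x.1).
have mg : measurable_fun setT g.
  apply: measurableT_comp => //; apply: measurable_fun_pair => /=.
    apply: measurable_funD => //; apply: measurable_funB; exact: measurable_funM.
  apply: measurable_funD => //; apply: measurable_funD; exact: measurable_funM.
have mc : measurable_fun setT c.
  by apply: measurable_funD => //; apply: measurable_funM => //;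
    exact: measurable_funB.
have mh : measurable_fun setT h.
  apply: measurableT_comp => //; apply: measurable_fun_pair => //=.
  apply: measurable_funD; first exact: measurable_funM.
  exact: (measurableT_comp mc).
have mfr y : measurable_fun setT (fun x => f (y, x)).
  by apply: measurableT_comp.
have mhl y : measurable_fun setT (fun x => h (x, y)).
  by apply: (measurableT_comp mh).
rewrite [X in (_ * X)%E](@fubini_tonelli2 _ _ _ _ _ mu mu g mg)//=.
have -> : (a ^+ 2 + b ^+ 2)%:E = (D%:E * a%:E)%E by rewrite -EFinM /D divfK.
rewrite -muleA -ge0_integralZl//=; last 3 first.
- exact: (measurable_fun_fubini_tonelli_G _ mg (fun x => f0 _)).
- by move=> y _; apply: integral_ge0 => x _; exact: f0.
- by rewrite lee_fin ltW.
transitivity (D%:E * \int[mu]_y \int[mu]_x h (x, y))%E; last first.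
  congr (_ * _)%E; apply: eq_integral => y _.
  rewrite (ge0_integral_affine (- b * y + z1) aN0)// ?/fubini_G; last 2 first.
  - exact: mhl.
  - by move=> x; exact: f0.
  rewrite gtr0_norm//; congr (_ * _)%E; apply: eq_integral => x _.
  congr (f (_, _)) => /=; first ring.
  by rewrite /c /D; field.
rewrite -(@fubini_tonelli _ _ _ _ _ mu mu h mh)//.
rewrite -ge0_integralZl//=; last 3 first.
- exact: (measurable_fun_fubini_tonelli_F _ mh (fun x => f0 _)).
- by move=> y _; apply: integral_ge0 => x _; exact: f0.
- by rewrite lee_fin ltW.
rewrite fubini_tonelli1//=.
by apply: eq_integral => x _; rewrite /fubini_F/=;
  rewrite (ge0_integral_affine (c x) (lt0r_neq0 D0))// gtr0_norm.
all: by move=> x; exact: f0.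
Qed.

End AffineChangeOfVariables.

Section IntegrableAffine.
Context {R : realType}.
Local Notation mu := (@lebesgue_measure R).
Local Notation mu2 := (mu \x mu)%E.

Variables (f : R * R -> R) (a b z1 z2 : R).
Hypothesis a0 : 0 < a.
Hypothesis intf : mu2.-integrable setT (EFin \o f).
Let g x := f (a * x.1 - b * x.2 + z1, a * x.2 + b * x.1 + z2).

Let D0 : 0 < a ^+ 2 + b ^+ 2.
Proof. by rewrite ltr_wpDr ?sqr_ge0// exprn_gt0. Qed.

Let mf : measurable_fun setT f.
Proof. by case/integrableP : intf => /measurable_EFinP. Qed.

Let mg : measurable_fun setT g.
Proof.
apply: measurableT_comp => //; apply: measurable_fun_pair => /=.
  apply: measurable_funD => //; apply: measurable_funB; exact: measurable_funM.
apply: measurable_funD => //; apply: measurable_funD; exact: measurable_funM.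
Qed.

Lemma integrable_complex_affine : mu2.-integrable setT (EFin \o g).
Proof.
apply/integrableP; split; first exact/measurable_EFinP.
case/integrableP : intf => _.
rewrite (@ge0_integral_complex_affine _ _ a b z1 z2)//; last first.
  exact/measurableT_comp/measurable_EFinP.
set I := (X in (_ * X < _)%E); have -> : (\int[mu2]_x `|(EFin \o g) x|)%E = I by [].
have : (0 <= I)%E by exact: integral_ge0.
case: I => [r||]//; first by move=> _ _; rewrite ltry.
by rewrite gt0_muley ?lte_fin.
Qed.

Lemma Rintegral_complex_affine : \int[mu2]_x f x =
  (a ^+ 2 + b ^+ 2) * \int[mu2]_x g x.
Proof.
have fin h : mu2.-integrable setT (EFin \o h) ->
    (\int[mu2]_x (h x)%:E)%E = (\int[mu2]_x h x)%:E.
  by move=> ih; rewrite fineK//; exact: integrable_fin_num.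
apply: EFin_inj; rewrite EFinM -!fin//; last exact: integrable_complex_affine.
have ig := integrable_complex_affine.
have P : (\int[mu2]_x (EFin \o f)^\+ x =
    (a ^+ 2 + b ^+ 2)%:E * \int[mu2]_x (EFin \o g)^\+ x)%E.
  rewrite (@ge0_integral_complex_affine _ _ a b z1 z2)//.
    by congr (_ * _)%E; apply: eq_integral => x _; rewrite !funeposE.
  exact/measurable_funepos/measurable_EFinP.
have N : (\int[mu2]_x (EFin \o f)^\- x =
    (a ^+ 2 + b ^+ 2)%:E * \int[mu2]_x (EFin \o g)^\- x)%E.
  rewrite (@ge0_integral_complex_affine _ _ a b z1 z2)//.
    by congr (_ * _)%E; apply: eq_integral => x _; rewrite !funenegE.
  exact/measurable_funeneg/measurable_EFinP.
rewrite (integralE mu2 setT (EFin \o f)) (integralE mu2 setT (EFin \o g)).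
rewrite P N [RHS]muleBr//; apply: fin_num_adde_defl.
by rewrite fin_numN; exact: integrable_neg_fin_num.
Qed.

End IntegrableAffine.

Section ComplexIntegral.
Local Open Scope complex_scope.
Context {R : realType}.
Local Notation C := R[i].
Local Notation re := (@complex.Re R).
Local Notation im := (@complex.Im R).

Lemma reD (x y : C) : re (x + y) = re x + re y. Proof. by case: x; case: y. Qed.
Lemma imD (x y : C) : im (x + y) = im x + im y. Proof. by case: x; case: y. Qed.
Lemma reM (x y : C) : re (x * y) = re x * re y - im x * im y.
Proof. by case: x; case: y. Qed.
Lemma imM (x y : C) : im (x * y) = re x * im y + im x * re y.
Proof. by case: x; case: y. Qed.
Lemma reJ (x : C) : re (Num.conj x) = re x. Proof. by case: x. Qed.
Lemma imJ (x : C) : im (Num.conj x) = - im x. Proof. by case: x. Qed.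
Lemma complex_ext (x y : C) : re x = re y -> im x = im y -> x = y.
Proof. by case: x => a b; case: y => c d /= -> ->. Qed.

Section Measurable.
Context d (T : measurableType d).
Implicit Types f g : T -> C.

Definition cmeasurable f :=
  measurable_fun setT (fun x => re (f x)) /\
  measurable_fun setT (fun x => im (f x)).

Lemma cmeasurable_cst (k : C) : cmeasurable (fun=> k).
Proof. by split; exact: measurable_cst. Qed.

Lemma cmeasurableM f g : cmeasurable f -> cmeasurable g ->
  cmeasurable (fun x => f x * g x).
Proof.
move=> [f1 f2] [g1 g2]; split.
  by under eq_fun do rewrite reM; apply: measurable_funB; exact: measurable_funM.
by under eq_fun do rewrite imM; apply: measurable_funD; exact: measurable_funM.
Qed.

Lemma cmeasurableX f n : cmeasurable f -> cmeasurable (fun x => f x ^+ n).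
Proof.
move=> mf; elim: n => [|n IH]; first exact: cmeasurable_cst.
by under eq_fun do rewrite exprS; exact: cmeasurableM.
Qed.

Lemma cmeasurableJ f : cmeasurable f -> cmeasurable (fun x => Num.conj (f x)).
Proof.
move=> [f1 f2]; split; first by under eq_fun do rewrite reJ.
by under eq_fun do rewrite imJ; exact: measurable_funN.
Qed.

Lemma cmeasurableR (f : T -> R) : measurable_fun setT f ->
  cmeasurable (fun x => (f x)%:C).
Proof. by move=> mf; split => //=; exact: measurable_cst. Qed.

End Measurable.

Section Integral.
Context d (T : measurableType d) (m : {measure set T -> \bar R}).
Implicit Types f g : T -> C.

(** Both [cintR f] and [cintC f] are convertible to instances of this, the latter for [f \o cplx];
    later proofs pass between them by conversion in order to use linearity. *)
Definition cint f : C :=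
  Rintegral m setT (fun x => re (f x)) +i* Rintegral m setT (fun x => im (f x)).

Definition cintegrable f :=
  m.-integrable setT (EFin \o (fun x => re (f x))) /\
  m.-integrable setT (EFin \o (fun x => im (f x))).

Lemma eq_cint f g : f =1 g -> cint f = cint g.
Proof. by move=> /funext ->. Qed.

Lemma eq_cintegrable f g : f =1 g -> cintegrable f -> cintegrable g.
Proof. by move=> /funext ->. Qed.

Lemma cintegrableD f g : cintegrable f -> cintegrable g ->
  cintegrable (fun x => f x + g x).
Proof.
move=> [f1 f2] [g1 g2]; split.
  by apply: eq_integrable (integrableD _ f1 g1) => // x _ /=; rewrite reD.
by apply: eq_integrable (integrableD _ f2 g2) => // x _ /=; rewrite imD.
Qed.

Lemma cintD f g : cintegrable f -> cintegrable g ->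
  cint (fun x => f x + g x) = cint f + cint g.
Proof.
move=> [f1 f2] [g1 g2]; apply: complex_ext; rewrite /cint ?reD ?imD /=.
  by rewrite -RintegralD//; apply: eq_Rintegral => x _; rewrite reD.
by rewrite -RintegralD//; apply: eq_Rintegral => x _; rewrite imD.
Qed.

Lemma cintegrableZ (k : C) f : cintegrable f -> cintegrable (fun x => k * f x).
Proof.
move=> [f1 f2]; split.
  apply: eq_integrable (integrableB _ (integrableZl _ (re k) f1)
    (integrableZl _ (im k) f2)) => // x _ /=.
  by rewrite reM EFinB !EFinM.
apply: eq_integrable (integrableD _ (integrableZl _ (re k) f2)
  (integrableZl _ (im k) f1)) => // x _ /=.
by rewrite imM EFinD !EFinM.
Qed.

Lemma cintZ (k : C) f : cintegrable f -> cint (fun x => k * f x) = k * cint f.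
Proof.
move=> [f1 f2]; have iZ (r : R) h : m.-integrable setT (EFin \o h) ->
    m.-integrable setT (EFin \o (fun x => r * h x)).
  by move=> ih; apply: eq_integrable (integrableZl _ r ih).
apply: complex_ext; rewrite /cint ?reM ?imM /=.
  rewrite -!RintegralZl// -RintegralB//; try exact: iZ.
  by apply: eq_Rintegral => x _; rewrite reM.
rewrite -!RintegralZl// -RintegralD//; try exact: iZ.
by apply: eq_Rintegral => x _; rewrite imM.
Qed.

Lemma cintegrable_sum (I : Type) (s : seq I) (f : I -> T -> C) :
  (forall i, cintegrable (f i)) -> cintegrable (fun x => \sum_(i <- s) f i x).
Proof.
move=> intf; elim: s => [|i s IH].
  have i0 : m.-integrable setT (EFin \o (cst 0 : T -> R)) by exact: integrable0.
  by split; apply: eq_integrable i0 => // x _ /=; rewrite big_nil.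
by apply: eq_cintegrable (cintegrableD (intf i) IH) => x; rewrite big_cons.
Qed.

Lemma cint_sum (I : Type) (s : seq I) (f : I -> T -> C) :
  (forall i, cintegrable (f i)) ->
  cint (fun x => \sum_(i <- s) f i x) = \sum_(i <- s) cint (f i).
Proof.
move=> intf; elim: s => [|i s IH].
  rewrite big_nil; apply: complex_ext => /=; rewrite (_ : (fun _ => _) = cst 0);
    do ?[by rewrite Rintegral_cst// mul0r];
    by apply/funext => x; rewrite big_nil.
rewrite big_cons -IH -cintD//; last exact: cintegrable_sum.
by apply: eq_cint => x; rewrite big_cons.
Qed.

Lemma normc_re_im (z : C) : `|re z| <= Normc.normc z /\ `|im z| <= Normc.normc z.
Proof.
case: z => a b /=; split; rewrite -(ler_pXn2r (ltn0Sn 1)) ?nnegrE ?sqrtr_ge0//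
  sqr_sqrtr ?addr_ge0 ?sqr_ge0// real_normK ?num_real// ?lerDl ?lerDr sqr_ge0//.
Qed.

Lemma le_cintegrable f (g : T -> R) : cmeasurable f ->
  m.-integrable setT (EFin \o g) -> (forall x, Normc.normc (f x) <= g x) ->
  cintegrable f.
Proof.
move=> [m1 m2] intg fg; split; (apply: le_integrable intg;
  [by []|exact/measurable_EFinP|move=> x _; rewrite lee_fin]);
  apply: le_trans (ler_norm _); apply: le_trans (fg x);
  by case: (normc_re_im (f x)).
Qed.

Lemma cintegrable_measurable f : cintegrable f -> cmeasurable f.
Proof.
by move=> [/integrableP[/measurable_EFinP ? _] /integrableP[/measurable_EFinP]].
Qed.

End Integral.

Local Notation mu := (@lebesgue_measure R).
Local Notation mu2 := (mu \x mu)%E.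

Definition cplx (p : R * R) : C := p.1 +i* p.2.

Lemma cintegrable_affine (f : C -> C) (k z : C) : 0 < re k ->
  cintegrable mu2 (f \o cplx) ->
  cintegrable mu2 ((fun x => f (k * x + z)) \o cplx).
Proof.
case: k z => a b [z1 z2] /= a0 [f1 f2]; split.
  exact: (integrable_complex_affine (f := fun p => re (f (cplx p)))
    b z1 z2 a0 f1).
exact: (integrable_complex_affine (f := fun p => im (f (cplx p)))
  b z1 z2 a0 f2).
Qed.

Lemma cintC_affine (f : C -> C) (k z : C) : 0 < re k ->
  cintegrable mu2 (f \o cplx) ->
  cintC f = (re k ^+ 2 + im k ^+ 2)%:C * cintC (fun x => f (k * x + z)).
Proof.
case: k z => a b [z1 z2] /= a0 [f1 f2].
apply: complex_ext; rewrite ?reM ?imM /= mul0r ?subr0 ?addr0.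
  exact: (Rintegral_complex_affine (f := fun p => re (f (cplx p)))
    b z1 z2 a0 f1).
exact: (Rintegral_complex_affine (f := fun p => im (f (cplx p)))
  b z1 z2 a0 f2).
Qed.

End ComplexIntegral.

(** * Moments of the Gaussian *)

Section GaussianMoments.
Local Open Scope complex_scope.
Context {R : realType}.
Local Notation C := R[i].
Local Notation re := (@complex.Re R).
Local Notation im := (@complex.Im R).
Local Notation mu := (@lebesgue_measure R).
Local Notation mu2 := (mu \x mu)%E.

Lemma sqr_normc_cplx (p : R * R) :
  Normc.normc (cplx p) ^+ 2 = p.1 ^+ 2 + p.2 ^+ 2.
Proof. by rewrite /= sqr_sqrtr// addr_ge0// sqr_ge0. Qed.

Lemma normc_ge0 (z : C) : 0 <= Normc.normc z.
Proof. by case: z => a b /=; exact: sqrtr_ge0. Qed.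

Lemma mul_conjc (z : C) : z * Num.conj z = (Normc.normc z ^+ 2)%:C.
Proof.
case: z => a b; rewrite /= sqr_sqrtr ?addr_ge0 ?sqr_ge0//.
by apply: complex_ext => /=; ring.
Qed.

Lemma measurable_gauss2 :
  measurable_fun setT (fun p : R * R => expR (- (p.1 ^+ 2 + p.2 ^+ 2))).
Proof.
apply: measurableT_comp => //; apply: measurable_funN; apply: measurable_funD;
  exact: measurable_funX.
Qed.

Lemma integral_gauss2 :
  (\int[mu2]_p (expR (- (p.1 ^+ 2 + p.2 ^+ 2)))%:E = pi%:E)%E.
Proof.
pose f (p : measurableTypeR R * measurableTypeR R) :=
  (expR (- (p.1 ^+ 2 + p.2 ^+ 2)))%:E.
have mf : measurable_fun setT f.
  by have := measurable_gauss2; move/measurable_EFinP; exact.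
rewrite (@fubini_tonelli1 _ _ _ _ _ mu mu f mf); last first.
  by move=> x; rewrite lee_fin expR_ge0.
have gauss_ge0 x : (0 <= (gauss_fun x)%:E :> \bar R)%E.
  by rewrite lee_fin gauss_fun_ge0.
have mgauss : measurable_fun setT (fun x : R => (gauss_fun x)%:E).
  by have := @measurable_gauss_fun R; move/measurable_EFinP; exact.
transitivity (\int[mu]_x ((gauss_fun x)%:E * (Num.sqrt pi)%:E))%E.
  apply: eq_integral => x _; rewrite -integralT_gauss /fubini_F.
  rewrite -ge0_integralZl//; apply: eq_integral => y _.
  by rewrite /f/= -EFinM /gauss_fun -expRD opprD.
rewrite ge0_integralZr ?lee_fin ?sqrtr_ge0//.
by rewrite integralT_gauss -EFinM -expr2 sqr_sqrtr// pi_ge0.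
Qed.

Lemma integrable_gauss2 :
  mu2.-integrable setT (EFin \o (fun p : R * R => expR (- (p.1 ^+ 2 + p.2 ^+ 2)))).
Proof.
apply/integrableP; split.
  by have := measurable_gauss2; move/measurable_EFinP; exact.
under eq_integral do rewrite /= ger0_norm ?expR_ge0//.
by rewrite integral_gauss2 ltry.
Qed.

(** The pullback of [integrable_gauss2] along z -> z / sqrt 2; this wider Gaussian dominates all the
    moments. *)
Let integrable_wide_gauss : mu2.-integrable setT
  (EFin \o (fun p : R * R => expR (- ((p.1 ^+ 2 + p.2 ^+ 2) / 2)))).
Proof.
have s0 : 0 < (Num.sqrt 2)^-1 :> R by rewrite invr_gt0 sqrtr_gt0.
apply: eq_integrable (integrable_complex_affine 0 0 0 s0 integrable_gauss2) => //.
move=> p _ /=; congr (expR (- _))%:E.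
rewrite !mul0r !addr0 subr0 !exprMn !exprVn sqr_sqrtr//; ring.
Qed.

(** Half of the Gaussian absorbs the power: r <= s = 1 + r^2 <= k exp (s / k), and with k = 2 (m +
    1) the m-th power of the exponential is at most exp (s / 2). The factor exp (1 / 2) pays for the
    1 in s. *)
Lemma gauss_poly_bound (m : nat) (r : R) : 0 <= r ->
  r ^+ m * expR (- r ^+ 2) <=
  (2 * m.+1%:R) ^+ m * expR 2^-1 * expR (- (r ^+ 2 / 2)).
Proof.
move=> r0; set k := 2 * m.+1%:R; set s := 1 + r ^+ 2.
have k0 : 0 < k by rewrite mulr_gt0.
have s0 : 0 <= s by rewrite addr_ge0// sqr_ge0.
have rs : r <= s by rewrite /s; have := sqr_ge0 (r - 1); nra.
have sk : s <= k * expR (s / k).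
  rewrite mulrC -ler_pdivrMr//; apply: le_trans (expR_ge1Dx _).
  by rewrite lerDr.
have rm : r ^+ m <= k ^+ m * expR (s / 2).
  apply: le_trans (_ : (k * expR (s / k)) ^+ m <= _).
    by apply: lerXn2r; rewrite ?nnegrE ?(le_trans rs)// mulr_ge0 ?expR_ge0// ltW.
  rewrite exprMn ler_pM2l ?exprn_gt0// -expRM_natl ler_expR.
  have -> : m%:R * (s / k) = (s / 2) * (m%:R / m.+1%:R).
    by rewrite /k; field.
  by rewrite ler_piMr ?divr_ge0// ler_pdivrMr// mul1r ler_nat.
have -> : expR (- r ^+ 2) = expR (- s / 2) * (expR 2^-1 * expR (- (r ^+ 2 / 2))).
  by rewrite -!expRD /s; congr expR; field.
rewrite mulrA mulrA ler_pM2r ?expR_gt0// ler_pM2r ?expR_gt0//.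
apply: le_trans (ler_wpM2r (expR_ge0 _) rm) _.
by rewrite -mulrA -expRD mulNr subrr expR0 mulr1.
Qed.

Definition gaussian (z : C) : C := (expR (- Normc.normc z ^+ 2))%:C.

Definition moment_fun (a b : nat) (z : C) : C := z ^+ a * Num.conj z ^+ b * gaussian z.

Definition moment a b := cintC (moment_fun a b).

Lemma cmeasurable_cplx : cmeasurable (fun p : R * R => cplx p).
Proof. by split; [exact: measurable_fst|exact: measurable_snd]. Qed.

Lemma cmeasurable_gaussian : cmeasurable (gaussian \o cplx).
Proof.
apply: cmeasurableR; apply: (@eq_measurable_fun _ _ _ _ _
  (fun p : R * R => expR (- (p.1 ^+ 2 + p.2 ^+ 2)))).
  by move=> p _; rewrite /= sqr_sqrtr ?addr_ge0 ?sqr_ge0.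
exact: measurable_gauss2.
Qed.

Lemma normcX (z : C) n : Normc.normc (z ^+ n) = Normc.normc z ^+ n.
Proof.
elim: n => [|n IH]; first by rewrite !expr0 /= expr1n expr0n addr0 sqrtr1.
by rewrite !exprS Normc.normcM IH.
Qed.

Lemma normc_conj (z : C) : Normc.normc (Num.conj z) = Normc.normc z.
Proof. by case: z => a b /=; rewrite sqrrN. Qed.

Lemma normc_real (x : R) : Normc.normc x%:C = `|x|.
Proof. by rewrite /= expr0n addr0 sqrtr_sqr. Qed.

Lemma cintegrable_moment a b : cintegrable mu2 (moment_fun a b \o cplx).
Proof.
pose K : R := (2 * (a + b).+1%:R) ^+ (a + b) * expR 2^-1.
pose h (p : R * R) := K * expR (- ((p.1 ^+ 2 + p.2 ^+ 2) / 2)).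
apply: (@le_cintegrable _ _ _ mu2 _ h).
- apply: cmeasurableM; last exact: cmeasurable_gaussian.
  apply: cmeasurableM; apply: cmeasurableX; first exact: cmeasurable_cplx.
  exact/cmeasurableJ/cmeasurable_cplx.
- by apply: eq_integrable (integrableZl _ K integrable_wide_gauss).
- move=> p; rewrite /moment_fun !Normc.normcM !normcX normc_conj -exprD.
  rewrite normc_real ger0_norm ?expR_ge0// /h -sqr_normc_cplx.
  exact/gauss_poly_bound/normc_ge0.
Qed.

Lemma gaussian_unit (u z : C) : Normc.normc u = 1 -> gaussian (u * z) = gaussian z.
Proof. by move=> u1; rewrite /gaussian Normc.normcM u1 mul1r. Qed.

Lemma de_Moivre (t : R) n :
  (cos t +i* sin t) ^+ n = cos (n%:R * t) +i* sin (n%:R * t).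
Proof.
elim: n => [|n IH]; first by rewrite expr0 mul0r cos0 sin0.
rewrite exprS IH -natr1 mulrDl mul1r cosD sinD.
by apply: complex_ext => /=; ring.
Qed.

(* The substitution [z -> u z] with [u] on the unit circle multiplies the
   moment by [u ^ (a - b)]. *)
Lemma moment_neq a b : a != b -> moment a b = 0.
Proof.
move=> ab.
pose m := (maxn a b - minn a b)%N.
have m0 : (0 < m)%N by rewrite /m; lia.
(* The angle is small enough that cos t > 0, as [cintC_affine] requires, and that 0 < m t < pi, so
   u^m is not real. Since u^a conj(u)^b is u^m or its conjugate, it differs from 1. *)
pose t : R := m.+1%:R^-1.
pose u := cos t +i* sin t.
have t0 : 0 < t by rewrite invr_gt0.
have mt : m%:R * t < 1 by rewrite ltr_pdivrMr// mul1r ltr_nat.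
have u1 : Normc.normc u = 1 by rewrite /= cos2Dsin2 sqrtr1.
have reu : 0 < re u.
  rewrite /= cos_gt0_pihalf//; apply/andP; split.
    by rewrite (@lt_trans _ _ 0)// oppr_lt0 divr_gt0// pi_gt0.
  apply: lt_le_trans (_ : 1 <= _); first by rewrite invf_lt1// ltr1n.
  by rewrite ler_pdivlMr// mul1r pi_ge2.
have um : im (u ^+ m) != 0.
  rewrite de_Moivre /= gt_eqF// sin_gt0_pi// mulr_gt0 ?ltr0n//=.
  by apply: lt_le_trans mt (le_trans _ (pi_ge2 _)); rewrite ler1n.
have ur : u * Num.conj u = 1 by rewrite mul_conjc u1 expr1n.
have uab : u ^+ a * Num.conj u ^+ b != 1.
  have [le_ab|/ltnW le_ba] := leqP a b.
    rewrite -(subnKC le_ab) exprD mulrA -exprMn ur expr1n mul1r.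
    have -> : (b - a = m)%N by rewrite /m; lia.
    apply: contra um => /eqP/(congr1 im); rewrite -rmorphXn imJ /= => /eqP.
    by rewrite oppr_eq0.
  rewrite -(subnKC le_ba) exprD mulrAC -exprMn ur expr1n mul1r.
  have -> : (a - b = m)%N by rewrite /m; lia.
  by apply: contra um => /eqP ->.
have : moment a b = u ^+ a * Num.conj u ^+ b * moment a b.
  have n2 : re u ^+ 2 + im u ^+ 2 = 1 by exact: cos2Dsin2.
  have := cintC_affine 0 reu (cintegrable_moment a b).
  rewrite n2 mul1r -/(moment a b) => {1}->.
  have := cintZ (u ^+ a * Num.conj u ^+ b) (cintegrable_moment a b).
  rewrite -[X in _ = _ * X -> _]/(moment a b) => <-.
  apply: (@eq_cint _ _ _ mu2) => p; rewrite addr0 /moment_fun gaussian_unit//.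
  by rewrite rmorphM /= !exprMn; ring.
move/eqP; rewrite -subr_eq0 -{1}(mul1r (moment a b)) -mulrBl mulf_eq0 subr_eq0.
by rewrite eq_sym (negPf uab) => /eqP.
Qed.

Let rmom n := \int[mu2]_p ((p.1 ^+ 2 + p.2 ^+ 2) ^+ n * expR (- (p.1 ^+ 2 + p.2 ^+ 2))).

Let moment_funE n p :
  moment_fun n n (cplx p) =
  ((p.1 ^+ 2 + p.2 ^+ 2) ^+ n * expR (- (p.1 ^+ 2 + p.2 ^+ 2)))%:C.
Proof.
rewrite /moment_fun -exprMn mul_conjc /gaussian.
by rewrite -!rmorphXn sqr_normc_cplx -rmorphM.
Qed.

Let integrable_rmom n : mu2.-integrable setT (EFin \o (fun p : R * R =>
  (p.1 ^+ 2 + p.2 ^+ 2) ^+ n * expR (- (p.1 ^+ 2 + p.2 ^+ 2)))).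
Proof.
have [i1 _] := cintegrable_moment n n.
by apply: eq_integrable i1 => // p _ /=; rewrite moment_funE.
Qed.

Let momentE n : moment n n = (rmom n)%:C.
Proof.
apply: complex_ext => /=.
  by apply: eq_Rintegral => p _; rewrite moment_funE.
rewrite (_ : (fun _ => _) = cst 0) ?Rintegral_cst ?mul0r//.
by apply/funext => p; rewrite moment_funE.
Qed.

(* By scaling and [exp (- t x) >= exp (- x) (1 - (t - 1) x)].  Equality holds
   at [t = 1], so the derivative of the left-hand side vanishes there. *)
Let rmom_tangent n t : 0 < t ->
  t ^+ n.+1 * (rmom n - (t - 1) * rmom n.+1) <= rmom n.
Proof.
move=> t0; have t0' := ltW t0.
have s0 : 0 < Num.sqrt t by rewrite sqrtr_gt0.
rewrite [leRHS](Rintegral_complex_affine 0 0 0 s0 (integrable_rmom n)).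
rewrite expr0n/= addr0 sqr_sqrtr// exprS -mulrA ler_pM2l//.
have intB : mu2.-integrable setT (EFin \o (fun p : R * R =>
   (p.1 ^+ 2 + p.2 ^+ 2) ^+ n * expR (- (p.1 ^+ 2 + p.2 ^+ 2)) -
   (t - 1) * ((p.1 ^+ 2 + p.2 ^+ 2) ^+ n.+1 * expR (- (p.1 ^+ 2 + p.2 ^+ 2))))).
  by apply: eq_integrable (integrableB _ (integrable_rmom n)
    (integrableZl _ (t - 1) (integrable_rmom n.+1))).
have intZ := integrableZl measurableT (t - 1) (integrable_rmom n.+1).
rewrite /rmom -(RintegralZl (t - 1) measurableT (integrable_rmom n.+1)).
rewrite -(RintegralB measurableT (integrable_rmom n) intZ).
rewrite -(RintegralZl (t ^+ n) measurableT intB).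
apply: le_Rintegral => //.
- by apply: eq_integrable (integrableZl _ (t ^+ n) intB).
- exact: (integrable_complex_affine 0 0 0 s0 (integrable_rmom n)).
move=> [x y] _ /=; rewrite !mul0r !addr0 subr0.
rewrite !exprMn sqr_sqrtr// -mulrDr exprMn.
set r := x ^+ 2 + y ^+ 2.
have r0 : 0 <= r by rewrite addr_ge0// sqr_ge0.
rewrite -mulrA ler_wpM2l ?exprn_ge0//.
rewrite exprS [leLHS](_ : _ = r ^+ n * (expR (- r) * (1 - (t - 1) * r))); last by ring.
rewrite ler_wpM2l ?exprn_ge0//.
have -> : - (t * r) = - r + - ((t - 1) * r) by ring.
rewrite expRD ler_pM2l ?expR_gt0//; exact: expR_ge1Dx.
Qed.

(** The tangent inequality makes t = 1 an interior maximum; this plays the part of a radial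
    integration by parts. *)
Let rmomS n : rmom n.+1 = n.+1%:R * rmom n.
Proof.
pose f (t : R) := t ^+ n.+1 * (rmom n - (t - 1) * rmom n.+1).
have df (t : R) : is_derive t (1 : R) f
    (n.+1%:R * t ^+ n * (rmom n - (t - 1) * rmom n.+1) - t ^+ n.+1 * rmom n.+1).
  have dX : is_derive t (1 : R) (fun t : R => t ^+ n.+1) (n.+1%:R * t ^+ n).
    have := is_deriveX n.+1 (is_derive_id t (1 : R)).
    by rewrite exprfctE /GRing.scale /= mulr1.
  rewrite /f; apply: is_derive_eq; rewrite /GRing.scale /=; ring.
have f1 : f 1 = rmom n by rewrite /f expr1n subrr mul0r subr0 mul1r.
have [_] : is_derive (1 : R) (1 : R) f 0.
  apply: (@derive1_at_max _ _ 0 2) => //; rewrite ?in_itv/= ?ltr01 ?ltr1n//.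
  by move=> t; rewrite in_itv/= f1 => /andP[t0 _]; exact: rmom_tangent.
have [_ ->] := df 1; rewrite !expr1n subrr mul0r subr0 mul1r mulr1 => /eqP.
by rewrite subr_eq0 => /eqP ->.
Qed.

Lemma moment_eq n : moment n n = (pi * n`!%:R)%:C.
Proof.
rewrite momentE; congr (_%:C); elim: n => [|n IH].
  rewrite mulr1 /rmom -(_ : fine pi%:E = pi)// -integral_gauss2.
  by congr fine; apply: eq_integral => p _; rewrite expr0 mul1r.
by rewrite rmomS IH factS natrM; ring.
Qed.

End GaussianMoments.

(** * Interaction coefficients *)

Section CayleyPowers.
Local Open Scope complex_scope.
Context {R : realType}.
Local Notation C := R[i].
Local Notation mu := (@lebesgue_measure R).

Lemma Rintegral_odd (f : R -> R) : measurable_fun setT f ->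
  (forall x, f (- x) = - f x) -> \int[mu]_x f x = 0.
Proof.
move=> /measurable_EFinP mf fN; rewrite /Rintegral integralE.
rewrite (_ : (\int[mu]_x _^\- x)%E = (\int[mu]_x (EFin \o f)^\+ x)%E); last first.
  rewrite (@ge0_integral_affine _ _ (-1) 0) ?oppr_eq0//; last first.
    exact: measurable_funeneg.
  rewrite normrN1 mul1e; apply: eq_integral => x _.
  by rewrite funeposE funenegE /= addr0 mulN1r fN opprK.
(* If the common value is infinite, the difference is infinite too and [fine] sends it to 0. *)
by case: (integral _ _ _) => //= r; rewrite subrr.
Qed.

Lemma integralT_oneDsqrV : (\int[mu]_x ((1 + x ^+ 2)^-1)%:E = (pi : R)%:E)%E.
Proof.
rewrite ge0_symfun_integralT//=.
- rewrite (_ : [set x | _] = `[0, +oo[%classic); last first.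
    by apply/seteqP; split => x/=; rewrite in_itv/= andbT.
  by rewrite (integral0y_oneDsqr R) -EFinM; congr EFin; field.
- by move=> x; rewrite invr_ge0 addr_ge0 ?sqr_ge0.
- exact: continuous_oneDsqrV.
- by move=> x/=; rewrite sqrrN.
Qed.

Lemma integrable_oneDsqrV :
  mu.-integrable setT (EFin \o (fun x : R => (1 + x ^+ 2)^-1)).
Proof.
have m : measurable_fun setT (fun x : R => (1 + x ^+ 2)^-1).
  by apply: continuous_measurable_fun; exact: continuous_oneDsqrV.
apply/integrableP; split; first exact/measurable_EFinP.
under eq_integral do rewrite /= ger0_norm ?invr_ge0 ?addr_ge0 ?sqr_ge0//.
by rewrite integralT_oneDsqrV ltry.
Qed.

Lemma continuous_atanZ (g : R -> R) (t : R) :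
  continuous g -> continuous (fun x => g (t * atan x)).
Proof.
move=> cg x; apply: (@continuous_comp _ _ _ (fun x => t * atan x) g).
  by apply: cvgM; [exact: cvg_cst|exact: continuous_atan].
exact: cg.
Qed.

Lemma sin_natr_pi k : sin (k%:R * pi) = 0 :> R.
Proof.
elim: k => [|k IH]; first by rewrite mul0r sin0.
by rewrite -natr1 mulrDl mul1r sinDpi IH oppr0.
Qed.

(* The antiderivative of [(1 + cos (2 k atan x)) / (1 + x ^ 2)] is
   [atan x + sin (2 k atan x) / (2 k)]. *)
Lemma Rintegral_cos_atan (k : nat) : (0 < k)%N ->
  \int[mu]_x ((1 + x ^+ 2)^-1 * cos (k.*2%:R * atan x)) = 0.
Proof.
move=> k0; set t : R := k.*2%:R.
have t0 : t != 0 by rewrite pnatr_eq0 double_eq0 -lt0n.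
(* The added 1 makes the integrand nonnegative, as the improper fundamental theorem of calculus
   requires; its contribution, pi, is removed at the end. *)
pose f (x : R) := (1 + x ^+ 2)^-1 * (1 + cos (t * atan x)).
pose F (x : R) := atan x + t^-1 * sin (t * atan x).
have cf : continuous f.
  move=> x; apply: cvgM; first exact: continuous_oneDsqrV.
  by apply: cvgD; [exact: cvg_cst|apply: continuous_atanZ; exact: continuous_cos].
have cF : continuous F.
  move=> x; apply: cvgD; first exact: continuous_atan.
  by apply: cvgM; [exact: cvg_cst|apply: continuous_atanZ; exact: continuous_sin].
have dF (x : R) : is_derive x (1 : R) F (f x).
  have dt : is_derive x (1 : R) (fun x => t * atan x) (t * (1 + x ^+ 2)^-1).
    by apply: is_derive_eq; rewrite /GRing.scale/=; ring.
  have ds := @is_derive1_comp R sin (fun x => t * atan x) x _ _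
    (is_derive_sin _) dt.
  apply: is_derive_eq; rewrite /GRing.scale/= /f; field.
  by rewrite t0 gt_eqF// ltr_wpDr// sqr_ge0.
have f0 x : 0 <= f x.
  apply: mulr_ge0; first by rewrite invr_ge0 addr_ge0 ?sqr_ge0.
  by rewrite -[leLHS](subrr 1) lerD2l cos_geN1.
have Fy : F x @[x --> +oo] --> pi / 2.
  (* The frequency is even, so the boundary term at infinity is a multiple of sin (k pi) = 0. *)
  have -> : pi / 2 = pi / 2 + t^-1 * sin (t * (pi / 2)) :> R.
    have -> : t * (pi / 2) = k%:R * pi by rewrite /t -muln2 natrM; field.
    by rewrite sin_natr_pi mulr0 addr0.
  apply: cvgD; first exact: cvgy_atan.
  apply: cvgM; first exact: cvg_cst.
  apply: (@cvg_comp _ _ _ (fun x => t * atan x) sin); last exact: continuous_sin.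
  by apply: cvgM; [exact: cvg_cst|exact: cvgy_atan].
have If : (\int[mu]_x (f x)%:E = pi%:E)%E.
  rewrite ge0_symfun_integralT//=; last first.
    by move=> x; rewrite /f /= sqrrN atanN mulrN cosN.
  rewrite (_ : [set x | _] = `[0, +oo[%classic); last first.
    by apply/seteqP; split => x/=; rewrite in_itv/= andbT.
  rewrite (ge0_continuous_FTC2y _ _ Fy)//=.
  - by rewrite /F atan0 mulr0 sin0 mulr0 addr0 oppr0 addr0 -EFinM; congr EFin; field.
  - exact: continuous_subspaceT.
  - by apply: cvg_at_right_filter; exact: cF.
  - by move=> x _; rewrite derive1E; exact: derive_val.
have mc : measurable_fun setT (fun x : R => (1 + x ^+ 2)^-1 * cos (t * atan x)).
  apply: continuous_measurable_fun => x; apply: cvgM.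
    exact: continuous_oneDsqrV.
  by apply: continuous_atanZ; exact: continuous_cos.
have ic : mu.-integrable setT
    (EFin \o (fun x : R => (1 + x ^+ 2)^-1 * cos (t * atan x))).
  apply: le_integrable integrable_oneDsqrV => //; first exact/measurable_EFinP.
  move=> x _; rewrite lee_fin normrM ler_piMr//; exact: cos_max.
have := RintegralD measurableT integrable_oneDsqrV ic.
rewrite (_ : Rintegral _ _ _ = pi); last first.
  rewrite -[RHS]/(fine pi%:E) -If; congr fine; apply: eq_integral => x _.
  by rewrite /f mulrDr mulr1.
rewrite (_ : \int[mu]_x (1 + x ^+ 2)^-1 = pi); last first.
  by rewrite -[RHS]/(fine pi%:E) -integralT_oneDsqrV.
by move=> h; apply: (addrI pi); rewrite -h addr0.
Qed.

Definition cayley (l : R) : C := (1 - 'i%C * l%:C) / (1 + 'i%C * l%:C).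

(** With theta = atan l, cos theta (1 - i l) = exp (- i theta), and 1 + i l is the conjugate of 1 -
    i l; hence [cayley l] = exp (- 2 i theta), a point of the unit circle. *)
Lemma cayleyX_re_im m l :
  cayley l ^+ m = cos (m.*2%:R * atan l) +i* (- sin (m.*2%:R * atan l)).
Proof.
have d0 : 1 + l ^+ 2 != 0 by rewrite gt_eqF// ltr_wpDr// sqr_ge0.
have c0 : cos (atan l) != 0.
  by rewrite cos_atan invr_eq0 sqrtr_eq0 -ltNge ltr_wpDr// sqr_ge0.
have c2 : cos (atan l) ^+ 2 = (1 + l ^+ 2)^-1.
  by rewrite cos_atan exprVn sqr_sqrtr// addr_ge0// sqr_ge0.
have sE : sin (atan l) = l * cos (atan l).
  by have := atanK l; rewrite /tan => /(canRL (divfK c0)).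
have E : cos (- atan l) +i* sin (- atan l) = (cos (atan l))%:C * (1 - 'i%C * l%:C).
  by rewrite cosN sinN sE; apply: complex_ext => /=; ring.
have P : (1 - 'i%C * l%:C) * (1 + 'i%C * l%:C) = (1 + l ^+ 2)%:C :> C.
  by apply: complex_ext => /=; ring.
have nz : 1 + 'i%C * l%:C != 0 :> C.
  by rewrite eq_complex /= mul0r mul1r subr0 addr0 oner_eq0.
have -> : cayley l = (cos (- atan l) +i* sin (- atan l)) ^+ 2.
  apply: (mulIf nz); rewrite /cayley divfK// E exprMn -rmorphXn /= c2 expr2.
  by rewrite -!mulrA P mulrCA -rmorphM mulVf// mulr1.
rewrite -exprM mul2n de_Moivre mulrN cosN sinN.
by [].
Qed.

(** The weight is the inverse Jacobian of x -> (1 + i l) x + z, produced by the integration over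
    x. *)
Definition cayley_fun m (l : R) : C := (1 + l ^+ 2)^-1%:C * cayley l ^+ m.

Lemma cintegrable_cayleyX m : cintegrable mu (cayley_fun m).
Proof.
apply: le_cintegrable integrable_oneDsqrV _.
  split; rewrite /cayley_fun; under eq_fun do rewrite cayleyX_re_im /=.
    under eq_fun do rewrite mul0r subr0.
    apply: continuous_measurable_fun => x; apply: cvgM.
      exact: continuous_oneDsqrV.
    by apply: continuous_atanZ; exact: continuous_cos.
  under eq_fun do rewrite mul0r addr0 mulrN.
  apply: continuous_measurable_fun => x; apply: cvgN; apply: cvgM.
    exact: continuous_oneDsqrV.
  by apply: continuous_atanZ; exact: continuous_sin.
move=> l; rewrite Normc.normcM normc_real cayleyX_re_im /=.
by rewrite sqrrN cos2Dsin2 sqrtr1 mulr1 ger0_norm// invr_ge0 addr_ge0// sqr_ge0.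
Qed.

Lemma cint_cayleyX m : cintR (cayley_fun m) = if m == 0 then pi%:C else 0.
Proof.
have [->|m0] := eqVneq m 0%N.
  apply: complex_ext; rewrite /cintR /= /cayley_fun.
    by rewrite -[RHS]/(fine pi%:E) -integralT_oneDsqrV; congr fine;
      apply: eq_integral => x _; rewrite mulr1 mul0r subr0.
  apply: Rintegral_odd => [|x]; last first.
    by rewrite !mulr0 !mul0r addr0 oppr0.
  by case: (cintegrable_measurable (cintegrable_cayleyX 0)).
apply: complex_ext; rewrite /cintR /= /cayley_fun.
  rewrite -[RHS](@Rintegral_cos_atan m) ?lt0n//; apply: eq_Rintegral => x _.
  by rewrite cayleyX_re_im /= mul0r subr0.
apply: Rintegral_odd => [|x].
  by case: (cintegrable_measurable (cintegrable_cayleyX m)).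
by rewrite !cayleyX_re_im /= sqrrN atanN !mulrN sinN; ring.
Qed.

End CayleyPowers.

(** * The trilinear operator on the basis functions, and the wave *)

Section ResonantCoefficients.
Local Open Scope complex_scope.
Context {R : realType}.
Local Notation C := R[i].
Local Notation re := (@complex.Re R).
Local Notation im := (@complex.Im R).
Local Notation mu := (@lebesgue_measure R).
Local Notation mu2 := (mu \x mu)%E.

Definition polygauss (p : {poly C}) (n : nat) (w : C) : C :=
  p.[w] * Num.conj w ^+ n * gaussian w.

Lemma polygaussE p n w :
  polygauss p n w = \sum_(a < size p) p`_a * moment_fun a n w.
Proof.
rewrite /polygauss horner_coef !mulr_suml; apply: eq_bigr => a _.
by rewrite /moment_fun !mulrA.
Qed.

Lemma cintegrable_polygauss p n : cintegrable mu2 (polygauss p n \o @cplx R).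
Proof.
apply: (@eq_cintegrable _ _ _ mu2 (fun x => \sum_(a < size p)
    p`_a * (moment_fun a n \o @cplx R) x)).
  by move=> x; rewrite /= polygaussE.
by apply: cintegrable_sum => a; exact/cintegrableZ/cintegrable_moment.
Qed.

Lemma cintC_polygauss p n : cintC (polygauss p n) = p`_n * (pi * n`!%:R)%:C.
Proof.
transitivity (cint mu2 (fun x => \sum_(a < size p)
    p`_a * (moment_fun a n \o @cplx R) x)).
  by apply: (@eq_cint _ _ _ mu2) => x; exact: polygaussE.
rewrite cint_sum; last by move=> a; exact/cintegrableZ/cintegrable_moment.
transitivity (\sum_(a < size p) p`_a * moment a n).
  by apply: eq_bigr => a _; rewrite cintZ//; exact: cintegrable_moment.
have [np|pn] := ltnP n (size p).
  rewrite (bigD1 (Ordinal np))//= moment_eq big1 ?addr0// => a an.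
  by rewrite moment_neq ?mulr0//; apply: contra an => /eqP an; apply/eqP/val_inj.
rewrite nth_default// mul0r big1// => a _; rewrite moment_neq ?mulr0//.
by rewrite neq_ltn (leq_trans (ltn_ord a)).
Qed.

(* With [w = (1 + i l) x + z], one has [x + z = u + q v] and
   [l x^perp + z = u - q v] for [u = (w + z) / 2], [v = (w - z) / 2] and
   [q = cayley l]: the following is the polynomial in [q] and [w] that
   the first two factors of the integrand amount to. *)
Definition resonant_poly (n1 n2 : nat) (z : C) : {poly {poly C}} :=
  let u := 2^-1 *: ('X + z%:P) in let v := 2^-1 *: ('X - z%:P) in
  (u%:P + v *: 'X) ^+ n1 * (u%:P - v *: 'X) ^+ n2.

Lemma resonant_polyE n1 n2 (l : R) (x z : C) :
  let w := (1 + 'i%C * l%:C) * x + z in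
  (resonant_poly n1 n2 z).[(cayley l)%:P].[w] =
  (x + z) ^+ n1 * (l%:C * perp x + z) ^+ n2.
Proof.
move=> w; rewrite /resonant_poly hornerM !horner_exp !hornerE /=.
have d0 : 1 + 'i%C * l%:C != 0 :> C.
  by rewrite eq_complex /= mul0r mul1r subr0 addr0 oner_eq0.
have perpE : perp x = 'i%C * x by case: x @w => a b /=; apply: complex_ext => /=; ring.
congr (_ ^+ _ * _ ^+ _).
  by rewrite /cayley /w; field.
by rewrite /cayley /w perpE; field.
Qed.

Lemma sqr_normcE (z : C) : Normc.normc z ^+ 2 = re z ^+ 2 + im z ^+ 2.
Proof. by case: z => a b; rewrite (sqr_normc_cplx (a, b)). Qed.

Lemma phi_conj n (z : C) : Num.conj (phi n z) =
  ((Num.sqrt (pi * n`!%:R))^-1)%:C * Num.conj z ^+ n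
  * (expR (- (Normc.normc z ^+ 2 / 2)))%:C.
Proof. by rewrite /phi !rmorphM rmorphXn; congr (_ * _ * _); exact: conjc_real. Qed.

(** The points z, x + z, w and l x^perp + z are the consecutive vertices of a rectangle, so |x +
    z|^2 + |l x^perp + z|^2 = |w|^2 + |z|^2. The three Gaussian factors thus merge into exp (- |z|^2
    / 2) exp (- |w|^2). *)
Lemma resonant_integrandE n1 n2 n3 (l : R) (x z : C) :
  phi n1 (x + z) * phi n2 (l%:C * perp x + z) *
    Num.conj (phi n3 (x + l%:C * perp x + z)) =
  ((Num.sqrt (pi * n1`!%:R))^-1 * (Num.sqrt (pi * n2`!%:R))^-1 *
   (Num.sqrt (pi * n3`!%:R))^-1 * expR (- (Normc.normc z ^+ 2 / 2)))%:C *
  polygauss (resonant_poly n1 n2 z).[(cayley l)%:P] n3 ((1 + 'i%C * l%:C) * x + z).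
Proof.
have perpE : perp x = 'i%C * x by case: x => a b /=; apply: complex_ext => /=; ring.
rewrite phi_conj /polygauss resonant_polyE.
rewrite (_ : x + l%:C * perp x + z = (1 + 'i%C * l%:C) * x + z); last first.
  by rewrite perpE; ring.
set w := _ * x + z.
have gE : expR (- (Normc.normc (x + z) ^+ 2 / 2)) *
    expR (- (Normc.normc (l%:C * perp x + z) ^+ 2 / 2)) *
    expR (- (Normc.normc w ^+ 2 / 2)) =
    expR (- (Normc.normc z ^+ 2 / 2)) * expR (- Normc.normc w ^+ 2).
  rewrite -!expRD; congr expR; rewrite /w !sqr_normcE.
  by case: x {perpE w} => a b; case: z => c d /=; field.
rewrite /phi /gaussian !rmorphM /=.
transitivity (((Num.sqrt (pi * n1`!%:R))^-1)%:C * ((Num.sqrt (pi * n2`!%:R))^-1)%:C *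
   ((Num.sqrt (pi * n3`!%:R))^-1)%:C * ((x + z) ^+ n1 * (l%:C * perp x + z) ^+ n2)
   * Num.conj w ^+ n3 * (expR (- (Normc.normc (x + z) ^+ 2 / 2)) *
    expR (- (Normc.normc (l%:C * perp x + z) ^+ 2 / 2)) *
    expR (- (Normc.normc w ^+ 2 / 2)))%:C); first by rewrite !rmorphM /=; ring.
by rewrite gE rmorphM /=; ring.
Qed.

Lemma coef_addC_exp (z : C) n k : (('X + z%:P) ^+ n)`_k = z ^+ (n - k) *+ 'C(n, k).
Proof.
rewrite addrC exprDn coef_sum.
have [kn|nk] := ltnP k n.+1; last first.
  rewrite bin_small// mulr0n big1// => i _.
  by rewrite coefMn -polyC_exp coefCM coefXn gtn_eqF ?mulr0 ?mul0rn//
    (leq_ltn_trans _ nk)// -ltnS.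
rewrite (bigD1 (Ordinal kn))//= big1 ?addr0 => [|i ik].
  by rewrite coefMn -polyC_exp coefCM coefXn eqxx mulr1.
rewrite coefMn -polyC_exp coefCM coefXn (_ : (k == i) = false) ?mulr0 ?mul0rn//.
by apply/negbTE; apply: contra ik => /eqP ki; apply/eqP/val_inj.
Qed.

Section ResonantIntegral.
Variables (n1 n2 n3 : nat) (z : C).

Let K := (Num.sqrt (pi * n1`!%:R))^-1 * (Num.sqrt (pi * n2`!%:R))^-1 *
   (Num.sqrt (pi * n3`!%:R))^-1 * expR (- (Normc.normc z ^+ 2 / 2)).
Let P := resonant_poly n1 n2 z.
Let p l := P.[(cayley l)%:P].
Let k (l : R) : C := 1 + 'i%C * l%:C.

Let k0 l : 0 < re (k l).
Proof. by rewrite /= mul0r mul1r subr0 addr0. Qed.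

Definition resonant_integrand (l : R) (x : C) : C :=
  phi n1 (x + z) * phi n2 (l%:C * perp x + z) *
    Num.conj (phi n3 (x + l%:C * perp x + z)).

Let integrandE l : resonant_integrand l \o @cplx R =
  fun x => K%:C * ((fun x => polygauss (p l) n3 (k l * x + z)) \o @cplx R) x.
Proof. by apply/funext => x; rewrite /= /resonant_integrand resonant_integrandE. Qed.

Lemma cintegrable_resonant_integrand l :
  cintegrable mu2 (resonant_integrand l \o @cplx R).
Proof.
rewrite integrandE; apply: cintegrableZ.
exact/cintegrable_affine/cintegrable_polygauss.
Qed.

Let g (m : 'I_(size P)) l := K%:C * (pi * n3`!%:R)%:C * (P`_m)`_n3 *
  cayley_fun m l.

Let integralE : (fun l => cintC (resonant_integrand l)) =
  fun l => \sum_(m < size P) g m l.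
Proof.
apply/funext => l.
have iA := cintegrable_affine z (k0 l) (cintegrable_polygauss (p l) n3).
have D0 : 1 + l ^+ 2 != 0 by rewrite gt_eqF// ltr_wpDr// sqr_ge0.
have kE : re (k l) ^+ 2 + im (k l) ^+ 2 = 1 + l ^+ 2 by rewrite /=; ring.
have A : cintC (fun x => polygauss (p l) n3 (k l * x + z)) =
    (1 + l ^+ 2)^-1%:C * ((p l)`_n3 * (pi * n3`!%:R)%:C).
  rewrite -cintC_polygauss (cintC_affine z (k0 l) (cintegrable_polygauss (p l) n3)) kE.
  by rewrite mulrA -rmorphM mulVf// mul1r.
rewrite -[cintC _]/(cint mu2 (resonant_integrand l \o @cplx R)) integrandE.
rewrite (cintZ K%:C iA) -[cint _ _]/(cintC (fun x => polygauss (p l) n3 (k l * x + z))).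
rewrite A /p horner_coef coef_sum mulr_suml !mulr_sumr.
by apply: eq_bigr => m _; rewrite /g /cayley_fun -polyC_exp coefMC; ring.
Qed.

Lemma cintegrable_resonant_integral :
  cintegrable mu (fun l => cintC (resonant_integrand l)).
Proof.
rewrite integralE; apply: cintegrable_sum => m.
exact/cintegrableZ/cintegrable_cayleyX.
Qed.

(** The integral over l keeps the coefficient of q^0, and the integral over x extracts from it the
    coefficient of w^n3. If n3 > n1 + n2 the binomial coefficient is 0, so the truncated exponent of
    z is harmless. *)
Lemma resonantT_phi :
  resonantT (@phi R n1) (@phi R n2) (@phi R n3) z =
  ((Num.sqrt (pi * n1`!%:R))^-1 * (Num.sqrt (pi * n2`!%:R))^-1 *
   (Num.sqrt (pi * n3`!%:R))^-1 * expR (- (Normc.normc z ^+ 2 / 2)) *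
   (pi / 2) * (pi * n3`!%:R) * (2 ^- (n1 + n2)) * 'C(n1 + n2, n3)%:R)%:C *
  z ^+ (n1 + n2 - n3).
Proof.
rewrite -/K /resonantT.
rewrite -[cintR _]/(cint mu (fun l => cintC (resonant_integrand l))) integralE.
rewrite cint_sum; last by move=> m; exact/cintegrableZ/cintegrable_cayleyX.
transitivity (2^-1 * \sum_(m < size P) K%:C * (pi * n3`!%:R)%:C * (P`_m)`_n3 *
    (if m == 0 :> nat then pi%:C else 0)).
  congr (_ * _); apply: eq_bigr => m _; rewrite cintZ; last exact: cintegrable_cayleyX.
  by rewrite -cint_cayleyX.
have -> : \sum_(m < size P) K%:C * (pi * n3`!%:R)%:C * (P`_m)`_n3 *
    (if m == 0 :> nat then pi%:C else 0) =
    K%:C * (pi * n3`!%:R)%:C * (P`_0)`_n3 * pi%:C.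
  have [sP|] := ltnP 0 (size P).
    rewrite (bigD1 (Ordinal sP))//= big1 ?addr0// => i i0.
    by rewrite ifF ?mulr0//; apply/negbTE; apply: contra i0 => /eqP i0; apply/eqP/val_inj.
  rewrite leqn0 size_poly_eq0 => /eqP ->.
  by rewrite size_poly0 big_ord0 !coef0 mulr0 mul0r.
(* At q = 0 both factors u + q v and u - q v reduce to u = (w + z) / 2. *)
have -> : P`_0 = (2^-1 *: ('X + z%:P)) ^+ (n1 + n2).
  rewrite -horner_coef0 /P /resonant_poly hornerM !horner_exp !hornerE.
  by rewrite subr0 -exprD.
have c2 : (2^-1)%:C = 2^-1 :> C by rewrite fmorphV rmorph_nat.
have ce : (2 ^- (n1 + n2))%:C = 2^-1 ^+ (n1 + n2) :> C.
  by rewrite -exprVn -c2; exact: (rmorphXn (real_complex R)).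
have cn : ('C(n1 + n2, n3)%:R)%:C = 'C(n1 + n2, n3)%:R :> C by rewrite rmorph_nat.
rewrite exprZn coefZ coef_addC_exp -(mulr_natr (z ^+ _)).
have rcM (a b : R) : (a * b)%:C = a%:C * b%:C by exact: rmorphM.
by rewrite !rcM c2 ce cn; ring.
Qed.

(** Lets the time phase of the wave leave the operator. Constants are pulled out first from the
    integral over x, then from the one over l, each time using integrability. *)
Lemma resonantTZ (u : C) :
  resonantT (fun z => phi n1 z * u) (fun z => phi n2 z * u)
    (fun z => phi n3 z * u) z =
  u * u * Num.conj u * resonantT (@phi R n1) (@phi R n2) (@phi R n3) z.
Proof.
rewrite /resonantT mulrCA; congr (_ * _).
rewrite -[cintR (fun l => cintC (fun x => phi n1 _ * phi n2 _ * Num.conj (phi n3 _)))]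
  /(cint mu (fun l => cintC (resonant_integrand l))).
rewrite -(cintZ _ cintegrable_resonant_integral).
apply: (@eq_cint _ _ _ mu) => l.
rewrite -[cintC (resonant_integrand l)]/(cint mu2 (resonant_integrand l \o @cplx R)).
rewrite -(cintZ _ (cintegrable_resonant_integrand l)).
apply: (@eq_cint _ _ _ mu2) => x.
by rewrite /= /resonant_integrand rmorphM; ring.
Qed.

End ResonantIntegral.

Definition resonant_coef (n1 n2 n3 n4 : nat) : R :=
  pi / 2 * (n1 + n2)`!%:R / (2 ^+ (n1 + n2) *
  Num.sqrt (n1`!%:R * n2`!%:R * n3`!%:R * n4`!%:R)).

Lemma resonantT_phi_coef n1 n2 n3 n4 (z : C) : (n1 + n2 = n3 + n4)%N ->
  resonantT (@phi R n1) (@phi R n2) (@phi R n3) z =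
  (resonant_coef n1 n2 n3 n4)%:C * phi n4 z.
Proof.
move=> n12; rewrite resonantT_phi /phi.
have -> : (n1 + n2 - n3 = n4)%N by lia.
set A := (X in X%:C * _ = _).
suff -> : A = resonant_coef n1 n2 n3 n4 * (Num.sqrt (pi * n4`!%:R))^-1 *
    expR (- (Normc.normc z ^+ 2 / 2)).
  by rewrite !(rmorphM (real_complex R)) /=; ring.
have f0 n : (0 : R) < n`!%:R by rewrite ltr0n fact_gt0.
have p0 : 0 < pi :> R by exact: pi_gt0.
have s0 n : Num.sqrt n`!%:R != 0 :> R by rewrite sqrtr_eq0 -ltNge.
have sp0 : Num.sqrt pi != 0 :> R by rewrite sqrtr_eq0 -ltNge.
have sq n : n`!%:R = Num.sqrt n`!%:R ^+ 2 :> R by rewrite sqr_sqrtr// ltW.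
have spq : pi = Num.sqrt pi ^+ 2 :> R by rewrite sqr_sqrtr// ltW.
have bE : 'C(n1 + n2, n3)%:R * n3`!%:R * n4`!%:R = (n1 + n2)`!%:R :> R.
  rewrite -!natrM -(@bin_fact (n1 + n2) n3); last by lia.
  by congr (_%:R); rewrite (_ : (n1 + n2 - n3 = n4)%N) ?mulnA//; lia.
have f0' n := ltW (f0 n).
rewrite /A /resonant_coef -bE !sqrtrM ?mulr_ge0// ?(ltW p0)//.
(* Generalizing the radicals, and writing pi, n3! and n4! as squares of them, leaves an identity of
   rational functions for [field]. *)
move: (s0 n1) (s0 n2) (s0 n3) (s0 n4) sp0 (sq n3) (sq n4) spq.
move: (Num.sqrt pi) (Num.sqrt n1`!%:R) (Num.sqrt n2`!%:R) (Num.sqrt n3`!%:R)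
  (Num.sqrt n4`!%:R) (expR _) => p a b c d E a0 b0 c0 d0 p0' -> -> ->.
field.
by rewrite p0' a0 b0 c0 d0 expf_neq0.
Qed.

Lemma phi_mul_conj n (z : C) : phi n z * Num.conj (phi n z) =
  ((pi * n`!%:R)^-1)%:C * moment_fun n n z.
Proof.
have f0 : 0 <= pi * n`!%:R :> R by rewrite mulr_ge0// pi_ge0.
rewrite phi_conj /phi /moment_fun /gaussian.
rewrite -{3}(sqr_sqrtr f0) -exprVn.
rewrite (_ : expR (- Normc.normc z ^+ 2) = expR (- (Normc.normc z ^+ 2 / 2)) ^+ 2).
  by rewrite !(rmorphXn (real_complex R)); ring.
by rewrite -expRM_natl; congr expR; field.
Qed.

Lemma alphaE n1 n2 n3 n4 : (n1 + n2 = n3 + n4)%N ->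
  @alpha R n1 n2 n3 n4 = (resonant_coef n1 n2 n3 n4)%:C.
Proof.
move=> n12; rewrite /alpha.
have f0 : pi * n4`!%:R != 0 :> R by rewrite mulf_neq0 ?gt_eqF ?pi_gt0// ltr0n fact_gt0.
transitivity (cint mu2 (fun x => (resonant_coef n1 n2 n3 n4)%:C *
   ((pi * n4`!%:R)^-1)%:C * (moment_fun n4 n4 \o @cplx R) x)).
  apply: (@eq_cint _ _ _ mu2) => x.
  by rewrite (resonantT_phi_coef _ n12) -[LHS]mulrA phi_mul_conj; exact: mulrA.
rewrite cintZ; last exact: cintegrable_moment.
rewrite -[cint _ _]/(moment n4 n4) moment_eq -mulrA -(rmorphM (real_complex R)).
by rewrite mulVf// mulr1.
Qed.

Lemma omegaE N : @omega R N = (resonant_coef N N N N)%:C.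
Proof. exact: alphaE. Qed.

Definition cis (t : R) : C := cos t +i* sin t.

Lemma cisD s t : cis (s + t) = cis s * cis t.
Proof. by rewrite /cis cosD sinD; apply: complex_ext => /=; ring. Qed.

Lemma conj_cis t : Num.conj (cis t) = cis (- t).
Proof. by rewrite /cis cosN sinN. Qed.

Lemma cis0 : cis 0 = 1.
Proof. by rewrite /cis cos0 sin0. Qed.

Lemma is_cderive_cis (k : C) (s a t : R) :
  is_cderive (fun t => k * ((expR (s * t))%:C * cis (a * t))) t
    (k * (s +i* a) * ((expR (s * t))%:C * cis (a * t))).
Proof.
have ds (c : R) : is_derive t (1 : R) (fun t => c * t) c.
  by apply: is_derive_eq; rewrite /GRing.scale/=; ring.
have de := @is_derive1_comp R expR (fun t => s * t) t _ _ (is_derive_expR _) (ds s).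
have dc := @is_derive1_comp R cos (fun t => a * t) t _ _ (is_derive_cos _) (ds a).
have di := @is_derive1_comp R sin (fun t => a * t) t _ _ (is_derive_sin _) (ds a).
case: k => x y; split => /=.
  apply: is_derive_eq; rewrite /GRing.scale/=; ring.
apply: is_derive_eq; rewrite /GRing.scale/=; ring.
Qed.

Lemma cexp_phase (w t : R) : cexp (- ('i%C * w%:C * t%:C)) = cis (- w * t).
Proof.
rewrite /cexp /cis; have -> : - ('i%C * w%:C * t%:C) = 0 +i* (- w * t) :> C.
  by apply: complex_ext => /=; ring.
by rewrite /= expR0 mul1r.
Qed.

Lemma wave_resonant_solution N : resonant_solution (@wave R N).
Proof.
move=> t z; pose w := resonant_coef N N N N.
have wE s : @wave R N s = fun z => phi N z * cis (- w * s).
  by apply/funext => x; rewrite /wave omegaE cexp_phase.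
exists (phi N z * (0 +i* (- w)) * cis (- w * t)); split.
  have := is_cderive_cis (phi N z) 0 (- w) t.
  rewrite mul0r expR0 mul1r.
  rewrite (_ : (fun t => _) = (fun s => wave N s z))//.
  by apply/funext => s; rewrite wE mul0r expR0 mul1r.
rewrite wE resonantTZ (@resonantT_phi_coef N N N N)// -/w.
rewrite conj_cis -(mulrA (cis _)) -cisD subrr cis0 mulr1.
rewrite (_ : 0 +i* - w = - 'i%C * w%:C); last by apply: complex_ext => /=; ring.
have ii : 'i%C * 'i%C = -1 :> C by rewrite -expr2 sqr_i.
transitivity (- ('i%C * 'i%C) * (phi N z * w%:C * cis (- w * t))); first by ring.
by rewrite ii opprK mul1r; ring.
Qed.

End ResonantCoefficients.

(** * The linearized system *)

Section LinearizedSystem.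
Local Open Scope complex_scope.
Context {R : realType}.
Local Notation C := R[i].
Local Notation re := (@complex.Re R).
Local Notation im := (@complex.Im R).

Lemma conj_realc (x : R) : Num.conj x%:C = x%:C.
Proof. exact: conjc_real. Qed.

Lemma conj_mul (x y : C) : Num.conj (x * y) = Num.conj x * Num.conj y.
Proof. exact: rmorphM. Qed.

Lemma is_deriveZt (a t : R) : is_derive t (1 : R) (fun s => a * s) a.
Proof. by apply: is_derive_eq; rewrite /GRing.scale/=; ring. Qed.

Lemma is_derive_cosZ (a t : R) :
  is_derive t (1 : R) (fun s => cos (a * s)) (- sin (a * t) * a).
Proof.
exact: (@is_derive1_comp R cos (fun t => a * t) t _ _ (is_derive_cos _)
  (is_deriveZt a t)).
Qed.

Lemma is_derive_sinZ (a t : R) :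
  is_derive t (1 : R) (fun s => sin (a * s)) (cos (a * t) * a).
Proof.
exact: (@is_derive1_comp R sin (fun t => a * t) t _ _ (is_derive_sin _)
  (is_deriveZt a t)).
Qed.

Variable N : nat.

(** These three are the real numbers omega, a_k and b of the overview. *)
Definition freq : R := resonant_coef N N N N.
Definition self_coef (k : nat) : R := resonant_coef k N k N.
Definition cross_coef (k : nat) : R := resonant_coef (2 * N - k) k N N.

Lemma cross_coefC k : (k <= 2 * N)%N -> cross_coef (2 * N - k) = cross_coef k.
Proof.
move=> kN; rewrite /cross_coef /resonant_coef subKn// (addnC k).
by rewrite (mulrC k`!%:R).
Qed.

Lemma rotE (t : R) :
  cexp (- (2 * 'i%C * @omega R N * t%:C)) = cis (- (2 * freq) * t).
Proof.
have h : (2 * freq)%:C = 2 * freq%:C :> C by rewrite rmorphM rmorph_nat.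
by rewrite -cexp_phase omegaE -/freq h; congr cexp; ring.
Qed.

Lemma linearized_rhs_mid t c : linearized_rhs N t c N =
  2 * freq%:C * c N + freq%:C * cis (- (2 * freq) * t) * Num.conj (c N).
Proof. by rewrite /linearized_rhs eqxx rotE omegaE. Qed.

Lemma linearized_rhs_pair t c k : (k <= 2 * N)%N -> k != N ->
  linearized_rhs N t c k = 2 * (self_coef k)%:C * c k +
    (cross_coef k)%:C * cis (- (2 * freq) * t) * Num.conj (c (2 * N - k)%N).
Proof.
by move=> kN /negPf kN'; rewrite /linearized_rhs kN' kN rotE !alphaE//; lia.
Qed.

Lemma linearized_rhs_high t c k : (2 * N < k)%N ->
  linearized_rhs N t c k = 2 * (self_coef k)%:C * c k.
Proof.
move=> kN; rewrite /linearized_rhs alphaE// leqNgt kN /= ifF//.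
by apply/negbTE; lia.
Qed.

Definition sqmod (c : R -> nat -> C) (k : nat) (t : R) : R :=
  re (c t k) ^+ 2 + im (c t k) ^+ 2.

Lemma sqmod_ge0 c k t : 0 <= sqmod c k t.
Proof. by rewrite addr_ge0 ?sqr_ge0. Qed.

Section Solution.
Variable c : R -> nat -> C.
Hypothesis solc : linearized_solution N c.

Lemma linearized_re t k : is_derive t (1 : R) (fun s => re (c s k))
  (im (linearized_rhs N t (c t) k)).
Proof.
have [d [[dre _] <-]] := solc.2 t k.
by rewrite imM /= mul0r mul1r add0r.
Qed.

Lemma linearized_im t k : is_derive t (1 : R) (fun s => im (c s k))
  (- re (linearized_rhs N t (c t) k)).
Proof.
have [d [[_ dim] <-]] := solc.2 t k.
by rewrite reM /= mul0r mul1r sub0r opprK.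
Qed.

Lemma sqmod_high k t : (2 * N < k)%N -> sqmod c k t = sqmod c k 0.
Proof.
move=> kN; apply: is_derive_0_is_cst => {}t.
have dx := linearized_re t k; have dy := linearized_im t k.
rewrite linearized_rhs_high// reM imM /= in dx dy.
rewrite /sqmod; apply: is_derive_eq; rewrite /GRing.scale /=; ring.
Qed.

(* [S (|c_k|^2 + |c_l|^2) + 2 b Re (c_k c_l exp (2 i w t))] is a conserved
   quantity; it is definite when [b < |S|]. *)
Lemma sqmod_pair k : (k <= 2 * N)%N -> k != N ->
  let S := self_coef k + self_coef (2 * N - k) - freq in
  0 <= cross_coef k -> cross_coef k < `|S| ->
  exists M : R, forall t, sqmod c k t <= M.
Proof.
move=> kN kN'; set l := (2 * N - k)%N => S b0 bS.
set b := cross_coef k in b0 bS *.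
have lN : (l <= 2 * N)%N by rewrite leq_subr.
have lN' : l != N by rewrite /l; apply: contra kN' => /eqP; lia.
have lk : (2 * N - l = k)%N by rewrite /l; lia.
have bl : cross_coef l = b by rewrite /l cross_coefC.
pose w := freq.
pose E t := S * (re (c t k) ^+ 2 + im (c t k) ^+ 2 +
    (re (c t l) ^+ 2 + im (c t l) ^+ 2)) + 2 * b *
  ((re (c t k) * re (c t l) - im (c t k) * im (c t l)) * cos (- (2 * w) * t) +
   (re (c t k) * im (c t l) + im (c t k) * re (c t l)) * sin (- (2 * w) * t)).
have Ecst t : E t = E 0.
  apply: is_derive_0_is_cst => {}t.
  have dxk := linearized_re t k; have dyk := linearized_im t k.
  have dxl := linearized_re t l; have dyl := linearized_im t l.
  rewrite linearized_rhs_pair// -/l -/b -/w !(reM, imM, reD, imD, reJ, imJ) /= in dxk dyk.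
  rewrite linearized_rhs_pair// lk bl -/w !(reM, imM, reD, imD, reJ, imJ) /= in dxl dyl.
  have dc := is_derive_cosZ (- (2 * w)) t; have ds := is_derive_sinZ (- (2 * w)) t.
  rewrite /E; apply: is_derive_eq; rewrite /GRing.scale /= /S -/w.
  ring.
exists (`|E 0| / (`|S| - b)) => t; rewrite ler_pdivlMr ?subr_gt0//.
rewrite -(Ecst t) /E /sqmod.
have := cos2Dsin2 (- (2 * w) * t).
move: (cos _) (sin _) => C1 S1 CS.
move: (re (c t k)) (im (c t k)) (re (c t l)) (im (c t l)) => x y x' y'.
set r := _ * C1 + _ * S1.
set m := x ^+ 2 + y ^+ 2 + (x' ^+ 2 + y' ^+ 2).
(* (u, v) is c_l after an orthogonal map, chosen so that r = x u + y v. Then 2 |r| <= m follows from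
   the squares of (x + u, y + v) and (x - u, y - v), and |E| >= (|S| - b) m. *)
pose u := x' * C1 + y' * S1; pose v := x' * S1 - y' * C1.
have uv : u ^+ 2 + v ^+ 2 = x' ^+ 2 + y' ^+ 2.
  by rewrite -[RHS]mulr1 -CS /u /v; ring.
have r2 : `|2 * r| <= m.
  rewrite /m -uv ler_norml; apply/andP; split; rewrite -subr_ge0.
    rewrite (_ : _ - _ = (x + u) ^+ 2 + (y + v) ^+ 2) ?addr_ge0 ?sqr_ge0//.
    by rewrite /r /u /v; ring.
  rewrite (_ : _ - _ = (x - u) ^+ 2 + (y - v) ^+ 2) ?addr_ge0 ?sqr_ge0//.
  by rewrite /r /u /v; ring.
have m0 : 0 <= m by apply: le_trans r2.
apply: le_trans (lerB_normD _ _).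
rewrite normrM (ger0_norm m0) (mulrC 2) -mulrA normrM (ger0_norm b0).
apply: le_trans (_ : (`|S| - b) * m <= _).
  rewrite mulrC; apply: ler_wpM2l; first by rewrite subr_ge0 ltW.
  by rewrite /m lerDl addr_ge0 ?sqr_ge0.
by rewrite mulrBl lerD2l lerN2 ler_wpM2l.
Qed.

(* In the rotating frame [exp (i w t) c_N] the real part is constant and the
   imaginary part affine in time. *)
Lemma sqmod_mid : exists M : R, forall t, sqmod c N t <= M * (1 + t ^+ 2).
Proof.
pose w := freq.
pose C1 t := cos (- w * t); pose S1 t := sin (- w * t).
pose p t := re (c t N) * C1 t + im (c t N) * S1 t.
pose q t := im (c t N) * C1 t - re (c t N) * S1 t.
have CS t : C1 t ^+ 2 + S1 t ^+ 2 = 1 by exact: cos2Dsin2.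
have dxy t : is_derive t (1 : R) (fun s => re (c s N))
      (2 * w * im (c t N) + w * (2 * C1 t * S1 t * re (c t N) -
        (C1 t ^+ 2 - S1 t ^+ 2) * im (c t N))) /\
    is_derive t (1 : R) (fun s => im (c s N))
      (- (2 * w * re (c t N) + w * ((C1 t ^+ 2 - S1 t ^+ 2) * re (c t N) +
        2 * C1 t * S1 t * im (c t N)))).
  have dx := linearized_re t N; have dy := linearized_im t N.
  have cE : - (2 * freq) * t = - w * t + - w * t by rewrite /w; ring.
  rewrite linearized_rhs_mid !(reM, imM, reD, imD, reJ, imJ) /= in dx dy.
  rewrite cE cosD sinD -/(C1 t) -/(S1 t) -/w in dx dy.
  by split; [apply: is_derive_eq dx _|apply: is_derive_eq dy _]; ring.
have pcst t : p t = p 0.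
  apply: is_derive_0_is_cst => {}t; have [dx dy] := dxy t.
  have dc := is_derive_cosZ (- w) t; have ds := is_derive_sinZ (- w) t.
  rewrite /p /C1 /S1; apply: is_derive_eq; rewrite /GRing.scale /=.
  rewrite -/(C1 t) -/(S1 t) [LHS](_ : _ = w * (re (c t N) * S1 t - im (c t N) * C1 t) *
    (C1 t ^+ 2 + S1 t ^+ 2 - 1)); last by rewrite /w; ring.
  by rewrite CS subrr mulr0.
pose Q t := q t + 2 * w * p 0 * t.
have Qcst t : Q t = Q 0.
  apply: is_derive_0_is_cst => {}t; have [dx dy] := dxy t.
  have dc := is_derive_cosZ (- w) t; have ds := is_derive_sinZ (- w) t.
  rewrite /Q /q /C1 /S1; apply: is_derive_eq; rewrite /GRing.scale /=.
  rewrite -(pcst t) /p -/(C1 t) -/(S1 t).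
  rewrite [LHS](_ : _ = w * (re (c t N) * C1 t + im (c t N) * S1 t) *
    (1 - (C1 t ^+ 2 + S1 t ^+ 2))); last by rewrite /w; ring.
  by rewrite CS subrr mulr0.
(* From (q 0 - 2 w p 0 t)^2 <= 2 (q 0)^2 + 8 (w p 0)^2 t^2. *)
exists (p 0 ^+ 2 + 2 * q 0 ^+ 2 + 8 * (w * p 0) ^+ 2) => t.
have -> : sqmod c N t = p t ^+ 2 + q t ^+ 2.
  by rewrite /sqmod -[LHS]mulr1 -(CS t) /p /q; ring.
have -> : q t = q 0 - 2 * w * p 0 * t.
  by have := Qcst t; rewrite /Q mulr0 addr0 => <-; ring.
rewrite pcst; have := sqr_ge0 (q 0 + 2 * w * p 0 * t).
have := mulr_ge0 (sqr_ge0 (p 0)) (sqr_ge0 t).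
have := mulr_ge0 (sqr_ge0 (q 0)) (sqr_ge0 t).
have := sqr_ge0 (w * p 0).
nra.
Qed.

End Solution.

Lemma sqr_normc_sqmod (c : R -> nat -> C) k t :
  Normc.normc (c t k) ^+ 2 = sqmod c k t.
Proof. exact: sqr_normcE. Qed.

Lemma polynomial_not_exponential (K A s : R) : 0 < A -> 0 < s -> 0 <= K ->
  exists2 t, 0 <= t & K * (1 + t ^+ 2) < A * expR (s * t).
Proof.
move=> A0 s0 K0.
(* B t^3 is A times the cubic Taylor term of exp (s t). The witness t >= 1 satisfies B t = B + 2 K,
   whence K (1 + t^2) <= 2 K t^2 <= B t^3. *)
pose B := A * (s ^+ 3 / 6); have B0 : 0 < B by rewrite mulr_gt0// divr_gt0// exprn_gt0.
pose t := 1 + 2 * K / B.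
have t1 : 1 <= t by rewrite lerDl divr_ge0// ?mulr_ge0// ltW.
have t0 : 0 <= t by apply: le_trans t1.
exists t => //.
have h : s ^+ 3 / 6 * t ^+ 3 < expR (s * t).
  have := expR_ge1Dxn 2 (mulr_ge0 (ltW s0) t0).
  apply: lt_le_trans; rewrite exprMn (_ : 3`!%:R = 6)//.
  by rewrite mulrAC ltrDr.
apply: le_lt_trans (_ : B * t ^+ 3 < _); last by rewrite /B -mulrA ltr_pM2l.
apply: le_trans (_ : K * (2 * t ^+ 2) <= _).
  by rewrite ler_wpM2l// mulr_natl mulr2n lerD2r exprn_ege1.
rewrite (exprS t 2) (mulrA K) (mulrA B); apply: ler_wpM2r; first exact: sqr_ge0.
rewrite (_ : B * t = B + K * 2) ?lerDr ?ltW// /t; field.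
by rewrite gt_eqF.
Qed.

(** Modes beyond 2 N keep their modulus, so the infinite tail stays below the finite initial norm;
    the finitely many remaining modes add a quadratic polynomial in t. *)
Lemma not_exponentially_growing (c : R -> nat -> C) : linearized_solution N c ->
  (forall k, (k <= 2 * N)%N -> exists M, forall t, sqmod c k t <= M * (1 + t ^+ 2)) ->
  ~ exponentially_growing c.
Proof.
move=> solc bnd [s [A [s0 A0 growth]]].
have [M Mb] : exists M : nat -> R, forall k, (k <= 2 * N)%N ->
    forall t, sqmod c k t <= M k * (1 + t ^+ 2).
  have /choice[M Mb] : forall k, exists M, (k <= 2 * N)%N ->
      forall t, sqmod c k t <= M * (1 + t ^+ 2).
    move=> k; case: (leqP k (2 * N)) => [kN|_]; last by exists 0.
    by have [M Mb] := bnd k kN; exists M.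
  by exists M.
pose n := (2 * N).+1.
have n0 k t : (0 <= ((Normc.normc (c t k)) ^+ 2)%:E)%E by rewrite lee_fin sqr_ge0.
have L t : (sqnorm (c t) <= (\sum_(0 <= k < n) (sqmod c k t))%:E + sqnorm (c 0%R))%E.
  rewrite {1}/sqnorm (nneseries_split 0 n)// add0n.
  rewrite (eq_bigr (fun k => (sqmod c k t)%:E)); last first.
    by move=> k _; rewrite sqr_normc_sqmod.
  rewrite sumEFin leeD2l// /sqnorm [leRHS](nneseries_split 0 n)// add0n.
  rewrite eseries_cond (eq_eseriesr
    (g := fun k => ((Normc.normc (c 0%R k)) ^+ 2)%:E)); last first.
    by move=> k /andP[_ nk]; rewrite !sqr_normc_sqmod sqmod_high.
  by rewrite -eseries_cond leeDr// sume_ge0.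
have Z0 : (0 <= sqnorm (c 0%R))%E by exact: nneseries_ge0.
have Zfin : sqnorm (c 0%R) \is a fin_num by rewrite ge0_fin_numE//; exact: solc.1.
pose Z := fine (sqnorm (c 0%R)).
pose K := \sum_(0 <= k < n) `|M k| + Z.
have K0 : 0 <= K by rewrite addr_ge0 ?sumr_ge0// fine_ge0.
have KL t : (sqnorm (c t) <= (K * (1 + t ^+ 2))%:E)%E.
  have t1 : 1 <= 1 + t ^+ 2 by rewrite lerDl sqr_ge0.
  apply: le_trans (L t) _; rewrite -(fineK Zfin) -EFinD lee_fin -/Z mulrDl.
  apply: lerD; last by rewrite ler_peMr// fine_ge0.
  rewrite mulr_suml !big_mkord; apply: ler_sum => k _.
  apply: le_trans (Mb k _ t) _; first by rewrite -ltnS.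
  by rewrite ler_wpM2r ?(le_trans _ t1)// ler_norm.
have A20 : 0 < A ^+ 2 by rewrite exprn_gt0.
have s20 : 0 < 2 * s by rewrite mulr_gt0.
have [t t0] := polynomial_not_exponential A20 s20 K0.
apply/negP; rewrite -leNgt.
have := le_trans (growth t t0) (KL t); rewrite lee_fin.
by rewrite exprMn -expRM_natl mulrA.
Qed.

(* On the pair [k, l = 2 N - k] the exponent is [-i (w + D) + s] with
   [D = a_k - a_l] and [s ^ 2 = b ^ 2 - S ^ 2]. *)
Lemma linearly_unstable_pair k : (k <= 2 * N)%N -> k != N ->
  let S := self_coef k + self_coef (2 * N - k) - freq in
  0 < cross_coef k -> `|S| < cross_coef k -> linearly_unstable R N.
Proof.
move=> kN kN'; set l := (2 * N - k)%N => S b0 Sb.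
set b := cross_coef k in b0 Sb *.
have lN : (l <= 2 * N)%N by rewrite leq_subr.
have lN' : l != N by rewrite /l; apply: contra kN' => /eqP; lia.
have lk : (2 * N - l = k)%N by rewrite /l; lia.
have kl : k != l by rewrite /l; apply: contra kN' => /eqP; lia.
have bl : cross_coef l = b by rewrite /l cross_coefC.
pose w := freq; pose D := self_coef k - self_coef l.
pose s := Num.sqrt (b ^+ 2 - S ^+ 2).
have bS : 0 < b ^+ 2 - S ^+ 2.
  by rewrite subr_gt0 -(real_normK (num_real S)) ltr_pXn2r ?nnegrE// ltW.
have s0 : 0 < s by rewrite sqrtr_gt0.
have s2 : s ^+ 2 = b ^+ 2 - S ^+ 2 by rewrite sqr_sqrtr// ltW.
(* With amplitude b on k, the k-th equation forces the amplitude -S - i s on l. The relation s^2 +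
   S^2 = b^2 then solves the l-th equation and gives both components the modulus b exp (s t). *)
pose c t j : C := if j == k then b%:C * ((expR (s * t))%:C * cis (- (w + D) * t))
  else if j == l then ((- S) -i* s) * ((expR (s * t))%:C * cis ((D - w) * t))
  else 0.
have normc_c t j : Normc.normc (c t j) ^+ 2 =
    if (j == k) || (j == l) then (b * expR (s * t)) ^+ 2 else 0.
  have cis1 a : Normc.normc (cis a : C) = 1 by rewrite /= cos2Dsin2 sqrtr1.
  rewrite /c; have [_|jk] := eqVneq j k.
    by rewrite !Normc.normcM cis1 mulr1 !normc_real !ger0_norm ?expR_ge0 ?ltW.
  have [_|jl] := eqVneq j l; last by rewrite /= !expr0n addr0 sqrtr0 expr0n.
  rewrite !Normc.normcM cis1 mulr1 normc_real ger0_norm ?expR_ge0//.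
  rewrite (exprMn _ b) (exprMn _ (Normc.normc _)).
  by congr (_ * _); rewrite sqr_normcE /= !sqrrN s2; ring.
have sqnorm_c t : sqnorm (c t) = (2 * (b * expR (s * t)) ^+ 2)%:E.
  rewrite /sqnorm (nneseries_split 0 (2 * N).+1); last first.
    by move=> j _; rewrite lee_fin sqr_ge0.
  rewrite add0n eseries0; last first.
    move=> j jN _; rewrite normc_c ifF//; apply/negbTE; rewrite negb_or; lia.
  rewrite adde0 sumEFin; congr EFin; rewrite big_mkord.
  have kO : (k < (2 * N).+1)%N by [].
  have lO : (l < (2 * N).+1)%N by [].
  rewrite (bigD1 (Ordinal kO))//= (bigD1 (Ordinal lO))/=; last first.
    by rewrite -val_eqE /= eq_sym.
  rewrite big1 => [|j /andP[jk jl]]; first by rewrite !normc_c !eqxx orbT /=; ring.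
  by rewrite normc_c -!(inj_eq val_inj) /= in jk jl *; rewrite (negPf jk) (negPf jl).
exists c; split; last first.
  exists s, b; split => // t _.
  by rewrite sqnorm_c lee_fin mulr_natl mulr2n lerDl sqr_ge0.
split => [t|t j]; first by rewrite sqnorm_c ltry.
have [jN|Nj] := leqP j (2 * N); last first.
  exists 0; split; last first.
    rewrite linearized_rhs_high// /c !ifF ?mulr0//; apply/negbTE; lia.
  rewrite (_ : (fun s => c s j) = cst 0); first by split; exact: is_derive_cst.
  by apply/funext => x; rewrite /c !ifF//; apply/negbTE; lia.
have [->|jk] := eqVneq j k.
  exists (b%:C * (s +i* (- (w + D))) * ((expR (s * t))%:C * cis (- (w + D) * t))).
  split.
    rewrite (_ : (fun s => c s k) =
        fun t => b%:C * ((expR (s * t))%:C * cis (- (w + D) * t))).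
      exact: is_cderive_cis.
    by apply/funext => x; rewrite /c eqxx.
  rewrite linearized_rhs_pair// -/l /c eqxx (eq_sym l k) (negPf kl) eqxx -/b -/w.
  rewrite !conj_mul conj_cis conj_realc.
  have -> : Num.conj (- S -i* s) = - S +i* s by rewrite -[s in RHS]opprK.
  have ph : cis (- (w + D) * t) = cis (- (2 * w) * t) * cis (- ((D - w) * t)).
    by rewrite -cisD; congr cis; ring.
  transitivity ((2 * (self_coef k)%:C * b%:C + b%:C * (- S +i* s)) *
      ((expR (s * t))%:C * cis (- (w + D) * t))); last by rewrite ph; ring.
  rewrite !mulrA; congr (_ * _ * _); rewrite /D /S -/w; apply: complex_ext => /=; ring.
have [->|jl] := eqVneq j l.
  exists ((- S -i* s) * (s +i* (D - w)) * ((expR (s * t))%:C * cis ((D - w) * t))).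
  split.
    rewrite (_ : (fun s => c s l) =
        fun t => (- S -i* s) * ((expR (s * t))%:C * cis ((D - w) * t))).
      exact: is_cderive_cis.
    by apply/funext => x; rewrite /c (eq_sym l k) (negPf kl) eqxx.
  rewrite linearized_rhs_pair// lk /c eqxx (eq_sym l k) (negPf kl) eqxx bl -/w.
  rewrite !conj_mul conj_cis !conj_realc.
  have ph : cis ((D - w) * t) = cis (- (2 * w) * t) * cis (- (- (w + D) * t)).
    by rewrite -cisD; congr cis; ring.
  transitivity ((2 * (self_coef l)%:C * (- S -i* s) + (b ^+ 2)%:C) *
      ((expR (s * t))%:C * cis ((D - w) * t))); last first.
    by rewrite ph (rmorphXn (real_complex R)); ring.
  have b2 : b ^+ 2 = s ^+ 2 + S ^+ 2 by rewrite s2 subrK.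
  rewrite !mulrA; congr (_ * _ * _); rewrite b2 /D /S -/w; apply: complex_ext => /=; ring.
have [jNN|jN'] := eqVneq j N.
  exists 0; split; last first.
    rewrite {1}jNN linearized_rhs_mid /c -jNN (negPf jk) (negPf jl).
    by rewrite conjC0 !mulr0 addr0.
  rewrite (_ : (fun s => c s j) = cst 0); first by split; exact: is_derive_cst.
  by apply/funext => x; rewrite /c (negPf jk) (negPf jl).
exists 0; split; last first.
  rewrite linearized_rhs_pair// /c (negPf jk) (negPf jl).
  have jk' : (2 * N - j)%N != k by apply: contra jl => /eqP; rewrite /l; lia.
  have jl' : (2 * N - j)%N != l by apply: contra jk => /eqP; rewrite /l; lia.
  by rewrite (negPf jk') (negPf jl') conjC0 !mulr0 addr0.
rewrite (_ : (fun s => c s j) = cst 0); first by split; exact: is_derive_cst.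
by apply/funext => x; rewrite /c (negPf jk) (negPf jl).
Qed.

End LinearizedSystem.

(** * Size of the coefficients *)

Section Coefficients.
Context {R : realType}.
Variable N : nat.
Local Notation freq := (@freq R N).
Local Notation self_coef := (@self_coef R N).
Local Notation cross_coef := (@cross_coef R N).

Lemma resonant_coef_gt0 n1 n2 n3 n4 : 0 < @resonant_coef R n1 n2 n3 n4.
Proof.
have f0 n : 0 < n`!%:R :> R by rewrite ltr0n fact_gt0.
rewrite /resonant_coef divr_gt0 ?mulr_gt0 ?divr_gt0 ?pi_gt0 ?exprn_gt0 ?sqrtr_gt0//.
Qed.

(** The radicand of [self_coef] is a perfect square, which leaves a_j = (pi / 2) C(j + N, N) / 2^(j
    + N). *)
Lemma self_coefS k :
  self_coef k.+1 * (2 * k.+1%:R) = self_coef k * (k.+1 + N)%:R.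
Proof.
have E j : self_coef j = pi / 2 * (j + N)`!%:R / (2 ^+ (j + N) * (j`!%:R * N`!%:R)).
  rewrite /self_coef /resonant_coef.
  rewrite [X in Num.sqrt X](_ : _ = (j`!%:R * N`!%:R) ^+ 2); last by ring.
  rewrite sqrtr_sqr.
  by rewrite ger0_norm// mulr_ge0.
have f0 n : n`!%:R != 0 :> R by rewrite pnatr_eq0 -lt0n fact_gt0.
rewrite !E addSn !factS !natrM exprS; field.
by rewrite !f0 expf_neq0//= addrC natr1 pnatr_eq0.
Qed.

Lemma self_coef_mid : self_coef N = freq. Proof. by []. Qed.

Lemma cross_coef_mid : cross_coef N = freq.
Proof. by rewrite /cross_coef /freq mul2n -addnn addnK. Qed.

(** Here the radicand is no square in general, but b^2 is a constant over (2 N - k)! k!, so the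
    squares have rational ratios. *)
Lemma cross_coefS k : (k < 2 * N)%N ->
  cross_coef k ^+ 2 * (2 * N - k)%:R = cross_coef k.+1 ^+ 2 * k.+1%:R.
Proof.
move=> kN; have f0 n : 0 < n`!%:R :> R by rewrite ltr0n fact_gt0.
have fN n : n`!%:R != 0 :> R by rewrite gt_eqF.
have E j : (j <= 2 * N)%N -> cross_coef j ^+ 2 =
    (pi / 2 * (2 * N)`!%:R / 2 ^+ (2 * N)) ^+ 2 /
    ((2 * N - j)`!%:R * j`!%:R * N`!%:R * N`!%:R).
  move=> jN; rewrite /cross_coef /resonant_coef subnK// invfM mulrA exprMn exprVn.
  by rewrite sqr_sqrtr// !mulr_ge0.
rewrite !E//; last exact: ltnW.
have -> : (2 * N - k = (2 * N - k.+1).+1)%N by lia.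
rewrite !factS !natrM; field.
by rewrite !fN expf_neq0//= !(addrC 1) !natr1 !pnatr_eq0.
Qed.

End Coefficients.

(** Bounds a product of factors 1 - a_i by 1 / (1 + sum of the a_i): for X >= 1 and a >= 0, (1 - a)
    (X + a) = X - a (X + a - 1) <= X. The increments of [X] are the a_i, so ratios 1 - O (i / N)
    give decay like N / j^2. *)
Lemma descent_bound (R : realFieldType) (f X : nat -> R) (n : nat) :
  X 0%N = 1 -> (forall i, X i <= X i.+1) -> (forall i, 0 <= f i) ->
  (forall i, (i < n)%N -> f i.+1 <= f i * (1 - (X i.+1 - X i))) ->
  f n * X n <= f 0%N.
Proof.
move=> X0 Xi f0; elim: n => [|n IH] fS; first by rewrite X0 mulr1.
have X1 i : 1 <= X i by elim: i => [|i Xi1]; [rewrite X0|exact: le_trans (Xi i)].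
apply: le_trans (IH (fun i h => fS i (ltnW h))).
have a0 : 0 <= X n.+1 - X n by rewrite subr_ge0.
apply: le_trans (ler_wpM2r (le_trans ler01 (X1 _)) (fS n (ltnSn n))) _.
rewrite -mulrA ler_wpM2l//.
have := X1 n; move: a0; set a := X n.+1 - X n => a0 X1n.
have -> : X n.+1 = X n + a by rewrite /a addrC subrK.
have := mulr_ge0 a0 (_ : 0 <= X n + a - 1); rewrite subr_ge0.
move=> /(_ (le_trans X1n _)); rewrite lerDl => /(_ a0); lra.
Qed.

Section Bounds.
Context {R : realType}.
Variables (N j : nat).
Hypothesis jN : (j <= N)%N.
Hypothesis j16 : (16 * N < j ^ 2)%N.
Local Notation freq := (@freq R N).
Local Notation self_coef := (@self_coef R N).
Local Notation cross_coef := (@cross_coef R N).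

Let N0 : (0 < N)%N. Proof. by move: j16 jN; case: (N) => //; case: j. Qed.
Let NR : 0 < N%:R :> R. Proof. by rewrite ltr0n. Qed.
Let j17 : (16 < j)%N.
Proof.
by rewrite ltnNge; apply/negP => j16'; have := leq_mul j16' jN; rewrite mulnn; lia.
Qed.
Let freq0 : 0 < freq. Proof. exact: resonant_coef_gt0. Qed.

Lemma self_coef_low : self_coef (N - j) < freq / 3.
Proof.
pose f i := self_coef (N - i).
(* The increments are i / (2 N): the exact ratio is 1 - i / (2 N - i) <= 1 - i / (2 N). *)
pose X i : R := 1 + (i%:R * (i%:R - 1)) / (4 * N%:R).
have h : f j * X j <= f 0%N.
  apply: descent_bound.
  - by rewrite /X mul0r mul0r addr0.
  - move=> i; rewrite lerD2l ler_pM2r ?invr_gt0 ?mulr_gt0// -natr1.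
    by have : 0 <= i%:R :> R by []; nra.
  - by move=> i; exact/ltW/resonant_coef_gt0.
  - move=> i ij; have iN : (i < N)%N by exact: leq_trans jN.
    have := @self_coefS R N (N - i.+1).
    rewrite subnSK// -/(f i) -/(f i.+1) => E.
    have {}E : f i.+1 * (2 * N%:R - i%:R) = f i * (2 * (N%:R - i%:R)).
      rewrite -(natrB _ (ltnW iN)) E; congr (_ * _).
      by rewrite natrD natrB ?(ltnW iN)//; ring.
    have i0 : 0 <= i%:R :> R by [].
    have iN' : i%:R < N%:R :> R by rewrite ltr_nat.
    have D0 : 0 < 2 * N%:R - i%:R :> R by lra.
    rewrite -(ler_pM2r D0) E -[leRHS]mulrA; apply: ler_wpM2l.
      exact/ltW/resonant_coef_gt0.
    rewrite /X -natr1.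
    rewrite [X in _ <= X](_ : _ =
      2 * N%:R - i%:R - i%:R + i%:R ^+ 2 / (2 * N%:R)); last first.
      by field; rewrite gt_eqF.
    have : 0 <= i%:R ^+ 2 / (2 * N%:R) :> R by rewrite divr_ge0.
    lra.
rewrite /f subn0 self_coef_mid in h.
have X3 : 3 < X j.
  rewrite /X -ltrBlDl ltr_pdivlMr ?mulr_gt0//.
  have jR : 16 < j%:R :> R by rewrite ltr_nat.
  have : 16 * N%:R < j%:R ^+ 2 :> R by rewrite -natrX -natrM ltr_nat.
  nra.
rewrite ltr_pdivlMr//; apply: lt_le_trans h.
by rewrite ltr_pM2l//; exact: resonant_coef_gt0.
Qed.

Lemma self_coef_high : self_coef (N + j) < freq / 3.
Proof.
pose f i := self_coef (N + i).
(* The increments are (i + 1) / (4 N): the exact ratio is 1 - (i + 1) / (2 (N + i + 1)), and i + 1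
   <= N. Reaching 3 takes j (j + 1) > 16 N, one origin of the constant 16. *)
pose X i : R := 1 + (i%:R * (i%:R + 1)) / (8 * N%:R).
have h : f j * X j <= f 0%N.
  apply: descent_bound.
  - by rewrite /X mul0r mul0r addr0.
  - move=> i; rewrite lerD2l ler_pM2r ?invr_gt0 ?mulr_gt0// -natr1.
    by have : 0 <= i%:R :> R by []; nra.
  - by move=> i; exact/ltW/resonant_coef_gt0.
  - move=> i ij; have iN : (i < N)%N by exact: leq_trans jN.
    have := @self_coefS R N (N + i).
    rewrite -addnS -/(f i) -/(f i.+1) => E.
    have {}E : f i.+1 * (2 * (N%:R + i%:R + 1)) = f i * (2 * N%:R + i%:R + 1).
      by rewrite -addrA natr1 -natrD E; congr (_ * _); rewrite !natrD -natr1; ring.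
    have i0 : 0 <= i%:R :> R by [].
    have iN' : i%:R + 1 <= N%:R :> R by rewrite natr1 ler_nat.
    have D0 : 0 < 2 * (N%:R + i%:R + 1) :> R by lra.
    rewrite -(ler_pM2r D0) E -[leRHS]mulrA; apply: ler_wpM2l.
      exact/ltW/resonant_coef_gt0.
    rewrite /X -natr1.
    rewrite [X in _ <= X](_ : _ =
      2 * (N%:R + i%:R + 1) - (i%:R + 1) * ((N%:R + (i%:R + 1)) / (2 * N%:R))); last first.
      by field; rewrite gt_eqF.
    have P1 : (N%:R + (i%:R + 1)) / (2 * N%:R) <= 1 :> R.
      by rewrite ler_pdivrMr ?mulr_gt0//; lra.
    have Q0 : 0 <= i%:R + 1 :> R by lra.
    by have := ler_piMr Q0 P1; lra.
rewrite /f addn0 self_coef_mid in h.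
have X3 : 3 < X j.
  rewrite /X -ltrBlDl ltr_pdivlMr ?mulr_gt0//.
  have jR : 16 < j%:R :> R by rewrite ltr_nat.
  have : 16 * N%:R < j%:R ^+ 2 :> R by rewrite -natrX -natrM ltr_nat.
  nra.
rewrite ltr_pdivlMr//; apply: lt_le_trans h.
by rewrite ltr_pM2l//; exact: resonant_coef_gt0.
Qed.

Lemma cross_coef_low : cross_coef (N - j) < freq / 3.
Proof.
(* Since the recursion is for squares, the target is 9 instead of 3; [X j] exceeds it exactly when
   j^2 > 16 N. The increments (2 i + 1) / (2 N) come from the ratio 1 - (2 i + 1) / (N + i + 1). *)
pose f i := cross_coef (N - i) ^+ 2.
pose X i : R := 1 + i%:R ^+ 2 / (2 * N%:R).
have h : f j * X j <= f 0%N.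
  apply: descent_bound.
  - by rewrite /X expr0n mul0r addr0.
  - move=> i; rewrite lerD2l ler_pM2r ?invr_gt0 ?mulr_gt0// -natr1.
    by have : 0 <= i%:R :> R by []; nra.
  - by move=> i; exact: sqr_ge0.
  - move=> i ij; have iN : (i < N)%N by exact: leq_trans jN.
    have /(@cross_coefS R N) : (N - i.+1 < 2 * N)%N by lia.
    rewrite subnSK// -/(f i) -/(f i.+1) => E.
    have {}E : f i.+1 * (N%:R + i%:R + 1) = f i * (N%:R - i%:R).
      rewrite -(natrB _ (ltnW iN)) -E -addrA natr1 -natrD; congr (_ * _%:R); lia.
    have i0 : 0 <= i%:R :> R by [].
    have iN' : i%:R + 1 <= N%:R :> R by rewrite natr1 ler_nat.
    have D0 : 0 < N%:R + i%:R + 1 :> R by lra.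
    rewrite -(ler_pM2r D0) E -[leRHS]mulrA; apply: ler_wpM2l; first exact: sqr_ge0.
    rewrite /X -natr1.
    rewrite [X in _ <= X](_ : _ =
      N%:R + i%:R + 1 - (2 * i%:R + 1) * ((N%:R + (i%:R + 1)) / (2 * N%:R))); last first.
      by field; rewrite gt_eqF.
    have P1 : (N%:R + (i%:R + 1)) / (2 * N%:R) <= 1 :> R.
      by rewrite ler_pdivrMr ?mulr_gt0//; lra.
    have Q0 : 0 <= 2 * i%:R + 1 :> R by lra.
    by have := ler_piMr Q0 P1; lra.
rewrite /f subn0 cross_coef_mid in h.
have X3 : 9 < X j.
  rewrite /X -ltrBlDl ltr_pdivlMr ?mulr_gt0//.
  have : 16 * N%:R < j%:R ^+ 2 :> R by rewrite -natrX -natrM ltr_nat.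
  by lra.
have c0 : 0 < cross_coef (N - j) by exact: resonant_coef_gt0.
rewrite ltr_pdivlMr// -(@ltr_pXn2r _ 2%N) ?nnegrE ?(ltW freq0) ?(mulr_ge0 (ltW c0))//.
apply: lt_le_trans h; rewrite exprMn ltr_pM2l ?exprn_gt0//.
by rewrite (_ : 3 ^+ 2 = 9)//; ring.
Qed.

End Bounds.

(** * Stability for N <= 1, instability for N >= 2 *)

Section Stability.
Local Open Scope complex_scope.
Context {R : realType}.

Lemma cross_coef_gt0 N k : 0 < @cross_coef R N k.
Proof. exact: resonant_coef_gt0. Qed.

(** The alternative of a vanishing mode serves solutions supported on a single pair, so that the
    same criterion applies to a whole wave and to one subsystem. *)
Lemma not_growing_of_stable_pairs N (c : R -> nat -> R[i]) :
  linearized_solution N c ->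
  (forall k, (k <= 2 * N)%N -> k != N ->
    (forall t, sqmod c k t = 0) \/
    cross_coef N k < `|self_coef N k + self_coef N (2 * N - k) - freq N| :> R) ->
  ~ exponentially_growing c.
Proof.
move=> solc stab; apply: (not_exponentially_growing solc) => k kN.
have [->|kN'] := eqVneq k N; first exact: sqmod_mid.
have [c0|bS] := stab k kN kN'.
  by exists 0 => t; rewrite c0 mul0r.
have [M Mk] := sqmod_pair solc kN kN' (ltW (cross_coef_gt0 N k)) bS.
exists M => t; have M0 : 0 <= M by apply: le_trans (Mk 0); exact: sqmod_ge0.
by apply: le_trans (Mk t) _; rewrite ler_peMr// lerDl sqr_ge0.
Qed.

Lemma linearly_stable0 : linearly_stable R 0.
Proof.
move=> [c [solc]]; apply: (not_growing_of_stable_pairs solc) => k.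
by rewrite leqn0 => /eqP ->.
Qed.

(** The only pair is {0, 2}, with S = 3 omega / 4 and b^2 = omega^2 / 2, and 1 / 2 < 9 / 16. *)
Lemma linearly_stable1 : linearly_stable R 1.
Proof.
move=> [c [solc]]; apply: (not_growing_of_stable_pairs solc) => k k2 k1; right.
have f0 : 0 < freq 1 :> R by exact: resonant_coef_gt0.
have s0 : self_coef 1 0 = freq 1 :> R.
  by have := @self_coefS R 1 0; rewrite self_coef_mid; lra.
have s2 : self_coef 1 2 = 3 / 4 * freq 1 :> R.
  by have := @self_coefS R 1 1; rewrite self_coef_mid; lra.
have c0 : cross_coef 1 0 ^+ 2 = freq 1 ^+ 2 / 2 :> R.
  by have := @cross_coefS R 1 0 isT; rewrite cross_coef_mid subn0; lra.
suff : cross_coef 1 0 < `|self_coef 1 0 + self_coef 1 2 - freq 1| :> R.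
  have c2 : cross_coef 1 2 = cross_coef 1 0 :> R by exact: (@cross_coefC R 1 0 isT).
  case: k k2 k1 => [|[|[|k]]]// _ _ h.
  by rewrite c2 [X in `|X - _|]addrC.
rewrite s0 s2 ger0_norm; last by lra.
rewrite -(@ltr_pXn2r _ 2%N)// ?nnegrE; last 2 first.
- exact/ltW/cross_coef_gt0.
- by lra.
by rewrite c0; nra.
Qed.

(** Two steps of the recursions from N in each direction give exact values at N - 2 and N + 2. These
    are needed: b^2 and S^2 agree up to order 1 / N, and (b^2 - S^2) / omega^2 is only of order 1 /
    (2 N^2). *)
Lemma linearly_unstable_ge2 N : (2 <= N)%N -> linearly_unstable R N.
Proof.
move=> N2; pose n := N%:R : R; have n2 : 2 <= n by rewrite /n ler_nat.
have f0 : 0 < freq N :> R by exact: resonant_coef_gt0.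
apply: (@linearly_unstable_pair _ _ (N - 2)); [lia|lia|exact: cross_coef_gt0|].
rewrite (_ : 2 * N - (N - 2) = N.+2)%N; last by lia.
have nE1 : (N - 2).+1%:R = n - 1 :> R by rewrite (_ : (N - 2).+1 = N - 1)%N ?natrB//; lia.
have nE0 : (N - 1)%N.+1%:R = n :> R by rewrite subn1 prednK//; lia.
have nS1 : N.+1%:R = n + 1 :> R by rewrite -natr1.
have nS2 : N.+2%:R = n + 2 :> R by rewrite -addn2 natrD.
have E1 : (N - 2).+1 = (N - 1)%N by lia.
have E2 : (N - 1).+1 = N by lia.
have a1 : self_coef N (N - 1) * (2 * n) = freq N * (2 * n) :> R.
  have := @self_coefS R N (N - 1); rewrite nE0 E2 self_coef_mid => ->.
  by rewrite natrD -/n; ring.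
have {}a1 : self_coef N (N - 1) = freq N :> R.
  by apply: (mulIf _ a1); rewrite mulf_neq0// gt_eqF//; lra.
have a2 : self_coef N (N - 2) = freq N * ((2 * n - 2) / (2 * n - 1)) :> R.
  have := @self_coefS R N (N - 2); rewrite nE1 E1 a1.
  rewrite natrD natrB -/n; last by lia.
  move=> E; apply: (@mulIf _ (n - 1 + n)); first by rewrite gt_eqF//; lra.
  rewrite -E; field; rewrite gt_eqF//; lra.
have b1 : self_coef N N.+1 = freq N * ((2 * n + 1) / (2 * n + 2)) :> R.
  have := @self_coefS R N N; rewrite natrD nS1 self_coef_mid -/n => E.
  apply: (@mulIf _ (2 * (n + 1))); first by rewrite gt_eqF//; lra.
  rewrite E; field; rewrite gt_eqF//; lra.
have b2 : self_coef N N.+2 = freq N * ((2 * n + 1) / (2 * n + 4)) :> R.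
  have := @self_coefS R N N.+1; rewrite natrD nS2 b1 -/n => E.
  apply: (@mulIf _ (2 * (n + 2))); first by rewrite gt_eqF//; lra.
  rewrite E; field; apply/andP; split; rewrite gt_eqF//; lra.
have c1 : cross_coef N (N - 1) ^+ 2 = freq N ^+ 2 * (n / (n + 1)) :> R.
  have := @cross_coefS R N (N - 1); rewrite nE0 E2 cross_coef_mid.
  rewrite (_ : 2 * N - (N - 1) = N.+1)%N; last by lia.
  rewrite nS1 => /(_ _)E; apply: (@mulIf _ (n + 1)); first by rewrite gt_eqF//; lra.
  rewrite E; last by lia.
  field; rewrite gt_eqF//; lra.
have c2 : cross_coef N (N - 2) ^+ 2 =
    freq N ^+ 2 * (n * (n - 1) / ((n + 1) * (n + 2))) :> R.
  have := @cross_coefS R N (N - 2); rewrite nE1 E1 c1.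
  rewrite (_ : 2 * N - (N - 2) = N.+2)%N; last by lia.
  rewrite nS2 => /(_ _)E; apply: (@mulIf _ (n + 2)); first by rewrite gt_eqF//; lra.
  rewrite E; last by lia.
  field; apply/andP; split; rewrite gt_eqF//; lra.
rewrite a2 b2.
pose S := (4 * n ^+ 2 - 2 * n - 5) / ((2 * n + 4) * (2 * n - 1)).
rewrite (_ : _ - _ = freq N * S); last first.
  rewrite /S; field; apply/andP; split; rewrite gt_eqF//; lra.
have S0 : 0 < S by rewrite divr_gt0//; nra.
have fS0 : 0 < freq N * S by exact: mulr_gt0.
have c0 : 0 < cross_coef N (N - 2) :> R by exact: cross_coef_gt0.
rewrite gtr0_norm// -(@ltr_pXn2r _ 2%N)// ?nnegrE ?(ltW fS0) ?(ltW c0)//.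
rewrite c2 exprMn ltr_pM2l ?exprn_gt0//.
rewrite -subr_gt0 (_ : _ - _ = (8 * n ^+ 3 + 52 * n ^+ 2 - 53 * n - 25) /
   ((n + 1) * (2 * n + 4) ^+ 2 * (2 * n - 1) ^+ 2)); last first.
  rewrite /S; field; rewrite -?andbA; apply/and4P; split; rewrite gt_eqF//; lra.
have p1 : 0 < n + 1 by lra.
have p2 : 0 < 2 * n + 4 by lra.
have p3 : 0 < 2 * n - 1 by lra.
rewrite divr_gt0 ?mulr_gt0 ?exprn_gt0//.
have n3 : 2 * n ^+ 2 <= n ^+ 3 by rewrite (exprS n 2) ler_wpM2r// sqr_ge0.
have n4 : 2 * n <= n ^+ 2 by rewrite expr2 ler_wpM2r//; lra.
lra.
Qed.

End Stability.

(** * Counting the unstable modes *)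

Section UnstableModes.
Context {R : realType}.

(** By contraposition. If k > 2 N, all modes up to 2 N of a solution supported on the subsystem
    vanish; if k is far from N, its pair carries a definite conserved form. Growth is excluded in
    both cases. *)
Lemma unstable_modes_bound N k : unstable_modes R N k ->
  (k <= 2 * N)%N /\ (`|k - N| ^ 2 <= 16 * N)%N.
Proof.
move=> [c [solc supp growth]]; apply: contrapT => nk.
apply: (not_growing_of_stable_pairs solc _ growth) => i iN iN'.
have [ik|ik] := boolP ((i == k) || (i + k == 2 * N)%N); last first.
  by left=> t; move: ik; rewrite negb_or /sqmod => /andP[ik ik'];
    rewrite supp//= expr0n addr0.
have kN : (k <= 2 * N)%N by move: ik => /orP[/eqP<-//|/eqP]; lia.
pose j := `|k - N|%N.
have jN : (j <= N)%N by rewrite /j; lia.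
have j16 : (16 * N < j ^ 2)%N by rewrite ltnNge; apply/negP => j16; exact: nk.
have f0 : 0 < freq N :> R by exact: resonant_coef_gt0.
right; have [iE|iE] : i = (N - j)%N \/ i = (N + j)%N.
    by move: ik => /orP[/eqP ->|/eqP]; rewrite /j; lia.
- rewrite iE (_ : 2 * N - (N - j) = N + j)%N; last by lia.
  have := @self_coef_low R N j jN j16; have := @self_coef_high R N j jN j16.
  have := @cross_coef_low R N j jN j16 => b s' s.
  (* Both a's are below omega / 3, so S < - omega / 3, while b < omega / 3. *)
  by rewrite ltr0_norm; lra.
- rewrite iE (_ : N + j = 2 * N - (N - j))%N; last by lia.
  rewrite cross_coefC ?subKn; [|lia|lia].
  rewrite (_ : 2 * N - (N - j) = N + j)%N; last by lia.
  have := @self_coef_low R N j jN j16; have := @self_coef_high R N j jN j16.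
  have := @cross_coef_low R N j jN j16 => b s' s.
  by rewrite ltr0_norm; lra.
Qed.

(** Gives the count its meaning, as [fset_set] is empty by default on an infinite set. *)
Lemma finite_unstable_modes N : finite_set (unstable_modes R N).
Proof.
apply: (sub_finite_set _ (finite_II (2 * N).+1)) => k.
by move=> /unstable_modes_bound[kN _].
Qed.

Lemma nb_unstable_modes_le N :
  (nb_unstable_modes R N)%:R <= 8 * Num.sqrt N%:R + 1 :> R.
Proof.
have s0 : 0 <= 4 * Num.sqrt N%:R :> R by rewrite mulr_ge0// sqrtr_ge0.
pose m := Num.truncn (4 * Num.sqrt N%:R : R).
have mle : m%:R <= 4 * Num.sqrt N%:R :> R by rewrite truncn_le.
apply: (@le_trans _ _ (2 * m).+1%:R).
  rewrite ler_nat; apply: geq_card_fset_set.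
  (* The modes lie in the window of 2 m + 1 integers starting at N - m. If m > N the subtraction
     truncates to 0, and k <= 2 N still places k in it. *)
  apply: card_le_trans (card_image_le (addn (N - m)) `I_(2 * m).+1).
  apply: subset_card_le => k /unstable_modes_bound[kN k16].
  have km : (`|k - N| <= m)%N.
    rewrite truncn_ge_nat// -(@ler_pXn2r _ 2%N)// ?nnegrE//.
    rewrite exprMn sqr_sqrtr// -natrX (_ : 4 ^+ 2 = 16%:R); last by ring.
    by rewrite -natrM ler_nat.
  by exists (k - (N - m))%N => /=; lia.
by rewrite -natr1 natrM; lra.
Qed.

Lemma nb_unstable_modes_littleo :
  (fun N : nat => (nb_unstable_modes R N)%:R : R^o)
     =o_\oo (fun N : nat => N%:R : R^o).
Proof.
apply/eqoP => e e0.
(* For N >= 1, 8 sqrt N + 1 <= 9 sqrt N, which is at most e N once sqrt N >= 9 / e. *)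
exists (Num.truncn ((9 / e) ^+ 2)).+1 => // N /= hN.
have N1 : 1 <= Num.sqrt N%:R :> R.
  by rewrite -[leLHS]sqrtr1 ler_wsqrtr// ler1n; exact: leq_trans hN.
have h : 9 <= e * Num.sqrt N%:R.
  rewrite mulrC -ler_pdivrMr// -(@ler_pXn2r _ 2%N)// ?nnegrE ?sqrtr_ge0
    ?divr_ge0 ?(ltW e0)//.
  rewrite sqr_sqrtr// ltW// (lt_le_trans (truncnS_gt _))// ler_nat.
  exact: hN.
rewrite !ger0_norm//; apply: le_trans (nb_unstable_modes_le N) _.
rewrite -[X in e * X](@sqr_sqrtr _ N%:R)// expr2 mulrA.
apply: le_trans (_ : 9 * Num.sqrt N%:R <= _); first by lra.
by rewrite ler_wpM2r// sqrtr_ge0.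
Qed.

End UnstableModes.

Unset Implicit Arguments.

Theorem proposition8p3 (R : realType) :
  (forall N : nat, resonant_solution (@wave R N)) /\
  (linearly_stable R 0 /\ linearly_stable R 1) /\
  (forall N : nat, (2 <= N)%N -> linearly_unstable R N) /\
  ((forall N : nat, finite_set (unstable_modes R N)) /\
   (fun N : nat => (nb_unstable_modes R N)%:R : R^o)
     =o_\oo (fun N : nat => N%:R : R^o)).
Proof.
split; first exact: wave_resonant_solution.
split; first by split; [exact: linearly_stable0|exact: linearly_stable1].
split; first exact: linearly_unstable_ge2.
by split; [exact: finite_unstable_modes|exact: nb_unstable_modes_littleo].
Qed.
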